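(* Let $M$ and $N$ be matroids in $\mathfrak F\oplus\mathfrak F^{*}$ on the same countable ground set $E$. Then there exist a set $I$ independent in both $M$ and $N$ and a partition $E=E_M\sqcup E_N$ such that $I\cap E_M$ spans $E_M$ in $M$ and $I\cap E_N$ spans $E_N$ in $N$.
   Context: Matroids are possibly infinite: a matroid is a pair $M=(E,\mathcal I)$ with $\mathcal I\subseteq\mathcal P(E)$ such that (1) $\varnothing\in\mathcal I$; (2) $\mathcal I$ is closed under subsets; (3) for all $I,J\in\mathcal I$ with $J$ maximal in $\mathcal I$ and $I$ not maximal, there is $e\in J\setminus I$ with $I\cup\{e\}\in\mathcal I$; (4) for every $X\subseteq E$, every $I\in\mathcal I$ with $I\subseteq X$ extends to a maximal element of $\{J\in\mathcal I: J\subseteq X\}$. Circuits are minimal dependent sets. $\mathsf{span}_M(X)$ consists of $X$ together with those $e$ for which there is a circuit $C\ni e$ with $C\setminus\{e\}\subseteq X$; ''$A$ spans $B$'' means $B\subseteq\mathsf{span}_M(A)$. A matroid is finitary if all its circuits are finite, cofinitary if its dual is finitary; $\mathfrak F\oplus\mathfrak F^*$ is the class of matroids that are a direct sum of a finitary and a cofinitary matroid. *)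

(* Defs.v *)
From Stdlib Require Import Classical List.

Definition subset {E : Type} (A B : E -> Prop) : Prop := forall x, A x -> B x.

Definition maximal_in {E : Type} (P : (E -> Prop) -> Prop) (I : E -> Prop) : Prop :=
  P I /\ forall J, P J -> subset I J -> subset J I.

Record matroid (E : Type) : Type := Matroid {
  indep : (E -> Prop) -> Prop;
  indep_empty : indep (fun _ => False);
  indep_subset : forall I J, indep J -> subset I J -> indep I;
  indep_aug : forall I J, indep I -> ~ maximal_in indep I -> maximal_in indep J ->
      exists e, J e /\ ~ I e /\ indep (fun x => I x \/ x = e);
  indep_max : forall X I, indep I -> subset I X ->
      exists J, subset I J /\
        maximal_in (fun K => indep K /\ subset K X) J
}.
Arguments indep {E} _ _.

Definition circuit_of {E : Type} (ind : (E -> Prop) -> Prop) (C : E -> Prop) : Prop :=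
  ~ ind C /\ forall D, subset D C -> ~ ind D -> subset C D.

Definition finite_set {E : Type} (A : E -> Prop) : Prop :=
  exists l : list E, forall x, A x -> List.In x l.

Definition base_of {E : Type} (ind : (E -> Prop) -> Prop) (B : E -> Prop) : Prop :=
  maximal_in ind B.

Definition dual_indep {E : Type} (M : matroid E) (I : E -> Prop) : Prop :=
  exists B, base_of (indep M) B /\ forall x, I x -> ~ B x.

Definition circuit {E : Type} (M : matroid E) := circuit_of (indep M).

Definition span {E : Type} (M : matroid E) (X : E -> Prop) : E -> Prop :=
  fun e => X e \/ exists C, circuit M C /\ C e /\ forall x, C x -> x <> e -> X x.

Definition spans {E : Type} (M : matroid E) (A B : E -> Prop) : Prop :=
  subset B (span M A).

(* A matroid is in F (+) F^*: the ground set splits as A ⊔ B with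
   M = M|A ⊕ M|B, M|A finitary and M|B cofinitary. Circuits of M|A are the
   circuits of M inside A; circuits of (M|B)^* = M^*|B (for a direct sum)
   are the circuits of M^* inside B. *)
Definition finitary_plus_cofinitary {E : Type} (M : matroid E) : Prop :=
  exists A : E -> Prop,
    (forall I, indep M I <->
        (indep M (fun x => I x /\ A x) /\ indep M (fun x => I x /\ ~ A x))) /\
    (forall C, circuit M C -> subset C A -> finite_set C) /\
    (forall C, circuit_of (dual_indep M) C -> subset C (fun x => ~ A x) ->
       finite_set C).

Definition countable_type (E : Type) : Prop :=
  exists f : E -> nat, forall x y, f x = f y -> x = y.

(* Main.v *)
From Stdlib Require Import Classical List Arith Lia IndefiniteDescription
  FunctionalExtensionality PropExtensionality.
Require Import Defs.

(** Write P for M and Q for the dual N^*.  The conclusion asks for a set [W] that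
    is packed, i.e. contains disjoint sets spanning [W] in P and in Q, such that
    the rest of E is covered by an independent set of P/W and one of Q/W.  Take
    [W] to be the largest packed set.  Then (P/W, Q/W) is unhindered: no packed
    set has an element to spare.  A covering I ⊔ J is built in countably many
    steps, where committing an element to I (to J) means making it a loop of Q
    (of P), and every step keeps the pair unhindered.

    On the finitary parts, independence survives the limit.  On a cofinitary part
    of Q an element e is made safe by adding to I a set that spans e in N
    ([span_element]).  If that were impossible, one takes a sequence of sets [S n]
    that can be added to I.  They are chosen so that more and more elements are
    spanned in N, and so that exchange walks from the elements which can no longer
    be spanned stay inside the P-closure of [S n].  The parts met by these walks
    are then frozen, and their union is a hindrance in which e is to spare. *)

(** Where only the dual of Q is finitary, an increasing union of Q-free sets may fail to be Q-free,
    so feasibility at every finite stage says nothing about the limit. What does survive is that I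
    spans e in N: no set disjoint from I + e can then span e in Q. Hence each element of such a part
    gets one stage at which it is spanned for good.

    The sets [S n] in the proof of [span_element] need not increase. What makes them converge is a
    natural number: over [S ∪ outside S], finitely many elements suffice to N-span the first n
    elements of the part. Finitariness of N then brings a failure of the limit down to a single
    stage.

    Deleted and contracted elements stay in the ground type as loops, so all minors that occur live
    on E and can be compared directly. *)

Notation "A ∪ B" := (fun x => A x \/ B x) (at level 50, left associativity).
Notation "A ∖ B" := (fun x => A x /\ ~ B x) (at level 50, left associativity).
Notation "A ∩ B" := (fun x => A x /\ B x) (at level 40, left associativity).
Notation "{[ a ]}" := (fun x => x = a) (at level 0, a at level 99).
Notation "∁ A" := (fun x => ~ A x) (at level 35, right associativity).
Notation "A ⊆ B" := (subset A B) (at level 70).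

Ltac prop := apply NNPP; intro; tauto.
Ltac sets :=
  unfold subset in *; intros; cbv beta in *;
  repeat match goal with
    | H : _ /\ _ |- _ => destruct H
    | H : _ \/ _ |- _ => destruct H
    end; subst; solve [tauto | prop | intuition eauto | intuition congruence].

Lemma set_ext (E : Type) (A B : E -> Prop) : A ⊆ B -> B ⊆ A -> A = B.
Proof.
  intros HAB HBA. apply functional_extensionality; intro x.
  apply propositional_extensionality. split; auto.
Qed.

Lemma dependent_choice (T : Type) (inv : nat -> T -> Prop)
    (rel : nat -> T -> T -> Prop) (t0 : T) :
  inv 0 t0 ->
  (forall n t, inv n t -> exists t', inv (S n) t' /\ rel n t t') ->
  exists s : nat -> T, s 0 = t0 /\ forall n, inv n (s n) /\ rel n (s n) (s (S n)).
Proof.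
  intros H0 Hstep.
  pose (next := fun n (t : {t | inv n t}) =>
    constructive_indefinite_description _ (Hstep n (proj1_sig t) (proj2_sig t))).
  pose (s := fix s n : {t | inv n t} := match n with
    | 0 => exist _ t0 H0
    | S n => exist _ (proj1_sig (next n (s n))) (proj1 (proj2_sig (next n (s n))))
    end).
  exists (fun n => proj1_sig (s n)). split; [reflexivity|].
  intro n. split; [exact (proj2_sig (s n))|].
  exact (proj2 (proj2_sig (next n (s n)))).
Qed.

(** * Closure spaces *)

Definition free_in {E : Type} (c : (E -> Prop) -> E -> Prop) (S : E -> Prop) : Prop :=
  forall s, S s -> ~ c (S ∖ {[s]}) s.

(* [cl_fund]: for [S] free, [{s ∈ S | e ∉ cl (S - s)}] is the fundamental
   circuit of [e] in [S], minus [e] itself. *)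
Record space (E : Type) : Type := Space {
  cl : (E -> Prop) -> E -> Prop;
  cl_mono : forall X Y e, X ⊆ Y -> cl X e -> cl Y e;
  cl_in : forall (X : E -> Prop) e, X e -> cl X e;
  cl_idem : forall X e, cl (cl X) e -> cl X e;
  cl_exch : forall X e f, cl (X ∪ {[f]}) e -> ~ cl X e -> cl (X ∪ {[e]}) f;
  cl_fund : forall S e, free_in cl S -> cl S e ->
    cl (fun s => S s /\ ~ cl (S ∖ {[s]}) e) e;
  cl_base : forall Z X, free_in cl Z -> Z ⊆ X ->
    exists Y, Z ⊆ Y /\ Y ⊆ X /\ free_in cl Y /\ X ⊆ cl Y
}.
Arguments cl {E} _ _ _.
Arguments cl_mono {E} s {X Y e}.
Arguments cl_in {E} s {X e}.
Arguments cl_exch {E} s {X e f}.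
Arguments cl_fund {E} s {S e}.
Arguments cl_base {E} s {Z X}.
Notation free Q := (free_in (cl Q)).

Section Space.
Context {E : Type}.
Implicit Types (Q : space E) (X Y Z S : E -> Prop) (e f : E).

Lemma cl_trans Q X Y e : X ⊆ cl Q Y -> cl Q X e -> cl Q Y e.
Proof. intros H He. apply cl_idem. revert He. apply cl_mono. exact H. Qed.

Lemma free_subset Q X Y : free Q Y -> X ⊆ Y -> free Q X.
Proof.
  intros HY H s Hs Hc. apply (HY s (H s Hs)). revert Hc. apply cl_mono. sets.
Qed.

Lemma free_not_cl Q X Y s : free Q Y -> Y s -> X ⊆ Y -> ~ X s -> ~ cl Q X s.
Proof.
  intros HY Hs H Hn Hc. apply (HY s Hs). revert Hc. apply cl_mono.
  intros x Hx. split; [auto|]. intros ->. auto.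
Qed.

Lemma cl_remove Q X f e : cl Q (X ∪ {[f]}) e -> cl Q X f -> cl Q X e.
Proof.
  intros He Hf. revert He. apply cl_trans. intros x [Hx | ->]; [|exact Hf].
  apply cl_in; exact Hx.
Qed.

Lemma free_add Q S e : free Q S -> ~ cl Q S e -> free Q (S ∪ {[e]}).
Proof.
  intros HS He s Hs Hc.
  assert (Hse : s <> e).
  { intros ->. apply He. revert Hc. apply cl_mono. sets. }
  destruct Hs as [Hs | ->]; [|tauto].
  apply He. assert (H : cl Q ((S ∖ {[s]}) ∪ {[s]}) e).
  { apply cl_exch; [|auto]. revert Hc. apply cl_mono. sets. }
  revert H. apply cl_mono. sets.
Qed.

(** * Duality *)

Definition dual_cl Q X : E -> Prop := fun e => X e \/ ~ cl Q (fun x => ~ X x /\ x <> e) e.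

Lemma dual_exch Q X e f : dual_cl Q (X ∪ {[f]}) e -> ~ dual_cl Q X e -> dual_cl Q (X ∪ {[e]}) f.
Proof.
  unfold dual_cl. intros H Hn.
  destruct (classic (e = f)) as [->|Hef]; [left; sets|].
  right. intro Hf. destruct H as [H|H]; [sets|].
  apply not_or_and in Hn. destruct Hn as [HX Hn]. apply NNPP in Hn.
  apply H.
  apply (cl_remove Q _ f).
  - revert Hn. apply cl_mono. sets.
  - revert Hf. apply cl_mono. sets.
Qed.

(** If e violates this, a base [B1] of the complement of the dual closure of X (without e) does not
    span e, while an extension [B2] to the complement of X does. Some z of the fundamental circuit
    lies outside [B1]; exchange shows that z is not dually spanned by X, so [B1] spans z, although
    [B2] is free. *)
Lemma dual_idem Q X e : dual_cl Q (dual_cl Q X) e -> dual_cl Q X e.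
Proof.
  intro He. apply NNPP. intro Hn. destruct He as [He|He]; [tauto|].
  unfold dual_cl in Hn. apply not_or_and in Hn. destruct Hn as [HX Hn]. apply NNPP in Hn.
  set (Z := dual_cl Q X) in *.
  destruct (cl_base Q (Z := fun _ => False) (X := fun x => ~ Z x /\ x <> e))
    as [B1 [_ [HB1 [F1 S1]]]]; [sets|sets|].
  destruct (cl_base Q (Z := B1) (X := fun x => ~ X x /\ x <> e))
    as [B2 [H12 [HB2 [F2 S2]]]]; [exact F1| |].
  { intros x Hx. apply HB1 in Hx. unfold Z, dual_cl in Hx. sets. }
  assert (C2 : cl Q B2 e) by (revert Hn; apply cl_trans; exact S2).
  pose proof (cl_fund Q F2 C2) as HD.
  assert (Hz : exists z, B2 z /\ ~ cl Q (B2 ∖ {[z]}) e /\ ~ B1 z).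
  { apply NNPP. intro Hz. apply He. revert HD. apply cl_mono.
    intros x [Hx Hx']. apply HB1. apply NNPP. intro. apply Hz. exists x. auto. }
  destruct Hz as [z [Hz [Hze Hz1]]].
  assert (Hz2 : cl Q (fun x => ~ X x /\ x <> z) z).
  { assert (H : cl Q ((B2 ∖ {[z]}) ∪ {[e]}) z).
    { apply cl_exch; [|exact Hze]. revert C2. apply cl_mono. sets. }
    revert H. apply cl_mono. intros x [[Hx Hxz]| ->].
    - apply HB2 in Hx. tauto.
    - split; [exact HX|]. intros ->. apply HB2 in Hz. tauto. }
  destruct (HB2 z Hz) as [HzX Hze'].
  apply (free_not_cl Q B1 B2 z F2 Hz H12 Hz1).
  apply S1. split; [|exact Hze']. unfold Z, dual_cl. tauto.
Qed.

Lemma dual_fund Q S e : free_in (dual_cl Q) S -> dual_cl Q S e ->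
  dual_cl Q (fun s => S s /\ ~ dual_cl Q (S ∖ {[s]}) e) e.
Proof.
  intros HS He. destruct (classic (S e)) as [Se|Se].
  { left. split; [exact Se|]. apply HS; exact Se. }
  destruct He as [He|He]; [tauto|]. right. intro Hc. apply He.
  revert Hc. apply cl_trans. intros t [Ht Hte].
  destruct (classic (S t)) as [St|St]; [|apply cl_in; auto].
  apply NNPP. intro Htn. apply Ht. split; [exact St|]. intro Hd.
  destruct Hd as [Hd|Hd]; [tauto|]. apply Hd.
  assert (H1 : cl Q (fun x => ~ S x) t).
  { pose proof (HS t St) as H. unfold dual_cl in H. apply not_or_and in H.
    destruct H as [_ H]. apply NNPP in H. revert H. apply cl_mono. sets. }
  assert (H2 : cl Q ((fun x => ~ S x /\ x <> e) ∪ {[t]}) e).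
  { apply cl_exch; [|exact Htn]. revert H1. apply cl_mono. sets. }
  revert H2. apply cl_mono. intros x [Hx| ->]; [sets|]. split; [sets|]. exact Hte.
Qed.

(** Y is X minus a base B of the complement of Z that extends a base of the complement of X. Dual
    freeness of Z makes B span everything. *)
Lemma dual_base Q Z X : free_in (dual_cl Q) Z -> Z ⊆ X ->
  exists Y, Z ⊆ Y /\ Y ⊆ X /\ free_in (dual_cl Q) Y /\ X ⊆ dual_cl Q Y.
Proof.
  intros HZ HZX.
  destruct (cl_base Q (Z := fun _ => False) (X := fun x => ~ X x))
    as [B0 [_ [HB0 [F0 S0]]]]; [sets|sets|].
  destruct (cl_base Q (Z := B0) (X := fun x => ~ Z x))
    as [B [H0B [HB [FB SB]]]]; [exact F0| |].
  { intros x Hx. apply HB0 in Hx. sets. }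
  assert (Hfull : forall x, cl Q B x).
  { intro x. destruct (classic (Z x)) as [Zx|Zx]; [|auto].
    apply (cl_trans Q (fun x => ~ Z x)); [exact SB|].
    pose proof (HZ x Zx) as H. unfold dual_cl in H. apply not_or_and in H.
    destruct H as [_ H]. apply NNPP in H. revert H. apply cl_mono. sets. }
  exists (X ∖ B). split; [|split; [|split]].
  - intros x Hx. split; [auto|]. intro Bx. apply HB in Bx. tauto.
  - sets.
  - intros y [Hy HyB] [Hd|Hd]; [sets|]. apply Hd.
    generalize (Hfull y). apply cl_mono. intros x Hx. split; [sets|]. intros ->. tauto.
  - intros t Ht. destruct (classic (B t)) as [Bt|Bt]; [|left; tauto].
    right. intro Hc. apply (FB t Bt). revert Hc. apply cl_trans. intros x [Hx Hxt].
    destruct (classic (X x)) as [Xx|Xx].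
    + apply cl_in. split; [apply NNPP; tauto | exact Hxt].
    + apply (cl_mono Q (X := B0)); [|apply S0; exact Xx]. intros b Hb. split; [auto|].
      intros ->. apply HB0 in Hb. tauto.
Qed.

Definition dual Q : space E.
Proof.
  refine (Space E (dual_cl Q) _ _ _ _ _ _).
  - intros X Y e H [He|He]; [left; auto|].
    destruct (classic (Y e)); [left; auto|right].
    intro Hc. apply He. revert Hc. apply cl_mono. sets.
  - intros X e He. left. exact He.
  - apply dual_idem.
  - apply dual_exch.
  - apply dual_fund.
  - apply dual_base.
Defined.

Lemma dual_not Q X e : ~ X e -> (cl (dual Q) X e <-> ~ cl Q (fun x => ~ X x /\ x <> e) e).
Proof. intro HX. cbn. unfold dual_cl. tauto. Qed.

Lemma not_dual Q X e : ~ cl (dual Q) X e -> cl Q (fun x => ~ X x /\ x <> e) e.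
Proof. cbn. unfold dual_cl. intro H. apply NNPP. tauto. Qed.

Lemma not_cl_dual Q X e : ~ cl Q X e -> cl (dual Q) (fun x => ~ X x /\ x <> e) e.
Proof.
  intro H. right. intro Hc. apply H. revert Hc. apply cl_mono. sets.
Qed.

Lemma dual_disjoint Q X Y e : cl Q X e -> (forall x, X x -> ~ Y x) -> ~ X e -> ~ Y e -> ~ cl (dual Q) Y e.
Proof.
  intros HX Hd He HeY [H|H]; [tauto|]. apply H. revert HX. apply cl_mono.
  intros x Hx. split; [auto|]. intros ->. tauto.
Qed.

Lemma disjoint_dual Q X Y e : cl (dual Q) X e -> (forall x, X x -> ~ Y x) -> ~ X e -> ~ Y e -> ~ cl Q Y e.
Proof.
  intros HX Hd He HeY H. apply dual_not in HX; [|exact He]. apply HX. revert H. apply cl_mono.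
  intros x Hx. split; [|intros ->; tauto]. intro Hx'. apply (Hd x); auto.
Qed.

Lemma dual_dual Q X e : cl (dual (dual Q)) X e <-> cl Q X e.
Proof.
  cbn. unfold dual_cl. destruct (classic (X e)) as [He|He].
  - split; [intros _; apply cl_in; exact He | tauto].
  - split.
    + intros [H|H]; [tauto|]. apply NNPP. intro Hn. apply H. right. intro Hc. apply Hn.
      revert Hc. apply cl_mono. sets.
    + intro H. right. intros [[H1 H2]|H1]; [tauto|]. apply H1. revert H. apply cl_mono.
      intros x Hx. split; [|intros ->; tauto]. intros [H2 _]. tauto.
Qed.

(** * Contraction and loops *)

(** Elements cannot be added one at a time to an infinite set; instead, a base of X ∪ Z through Z is
    seen to contain all of X. *)
Lemma free_union Q X Z : free Q Z ->
  (forall x, X x -> ~ cl Q ((X ∖ {[x]}) ∪ Z) x) -> free Q (X ∪ Z).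
Proof.
  intros HZ HX. destruct (cl_base Q (Z := Z) (X := X ∪ Z)) as [Y [HZY [HYX [FY SY]]]];
    [exact HZ|sets|].
  apply (free_subset Q _ Y FY). intros x [Hx|Hx]; [|auto].
  apply NNPP. intro Hn. apply (HX x Hx).
  apply (cl_mono Q (X := Y)); [|apply SY; sets].
  intros y Hy. destruct (HYX y Hy); [|sets]. left. split; [auto|]. intros ->. tauto.
Qed.

Lemma contract_free Q Z B X : free Q B -> B ⊆ Z -> Z ⊆ cl Q B ->
  (forall x, X x -> ~ cl Q ((X ∖ {[x]}) ∪ Z) x) -> free Q (X ∪ B).
Proof.
  intros HB HBZ HZB HX. apply free_union; [exact HB|]. intros x Hx Hc. apply (HX x Hx).
  revert Hc. apply cl_mono. sets.
Qed.

Definition contract Q (C : E -> Prop) : space E.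
Proof.
  refine (Space E (fun X => cl Q (X ∪ C)) _ _ _ _ _ _).
  - intros X Y e H. apply cl_mono. sets.
  - intros X e H. apply cl_in. tauto.
  - intros X e. apply cl_trans. intros x [Hx|Hx]; [exact Hx|]. apply cl_in. tauto.
  - intros X e f H Hn.
    assert (H' : cl Q ((X ∪ C) ∪ {[e]}) f).
    { apply cl_exch; [|exact Hn]. revert H. apply cl_mono. sets. }
    revert H'. apply cl_mono. sets.
  - intros S e HS He.
    destruct (cl_base Q (Z := fun _ => False) (X := C)) as [B [_ [HB [FB SB]]]]; [sets|sets|].
    assert (FS := contract_free Q C B S FB HB SB HS).
    assert (He' : cl Q (S ∪ B) e).
    { revert He. apply cl_trans. intros x [Hx|Hx]; [apply cl_in; tauto|].
      generalize (SB x Hx). apply cl_mono. sets. }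
    generalize (cl_fund Q FS He'). apply cl_mono.
    intros s [[Hs|Hs] Hs']; [|right; auto].
    left. split; [exact Hs|]. intro Hc. apply Hs'. revert Hc. apply cl_trans.
    intros x [[Hx Hxs]|Hx]; [apply cl_in; tauto|].
    assert (Hns : ~ C s). { intro. apply (HS s Hs). apply cl_in. tauto. }
    generalize (SB x Hx). apply cl_mono. intros y Hy. split; [tauto|]. intros ->. auto.
  - intros Z X HZ HZX.
    destruct (cl_base Q (Z := fun _ => False) (X := C)) as [B [_ [HB [FB SB]]]]; [sets|sets|].
    assert (FZ := contract_free Q C B Z FB HB SB HZ).
    destruct (cl_base Q (Z := Z ∪ B) (X := X ∪ C)) as [Y [HY1 [HY2 [FY SY]]]]; [exact FZ|sets|].
    exists (Y ∖ C). split; [|split; [|split]].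
    + intros x Hx. split; [sets|]. intro Cx. apply (HZ x Hx). apply cl_in. tauto.
    + intros x [Hx HC]. destruct (HY2 x Hx); tauto.
    + intros y [Hy HyC] Hc. apply (FY y Hy). revert Hc. apply cl_trans.
      intros x [Hx|Hx]; [apply cl_in; tauto|].
      generalize (SB x Hx). apply cl_mono. intros b Hb. split; [apply HY1; tauto|].
      intros ->. auto.
    + intros x Hx. assert (H := SY x (or_introl Hx)). revert H. apply cl_mono. sets.
Defined.

(** Deletion of J with the deleted elements kept as loops. In the dual, J is contracted and its
    elements become coloops. *)
Definition loop Q (J : E -> Prop) : space E.
Proof.
  refine (Space E (fun X e => J e \/ cl Q (X ∖ J) e) _ _ _ _ _ _).
  - intros X Y e H [He|He]; [tauto|right]. revert He. apply cl_mono. sets.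
  - intros X e He. destruct (classic (J e)); [tauto|right]. apply cl_in. tauto.
  - intros X e [He|He]; [tauto|right]. revert He. apply cl_trans. sets.
  - intros X e f H Hn. apply not_or_and in Hn. destruct Hn as [HJ Hn].
    destruct H as [H|H]; [tauto|]. destruct (classic (J f)) as [Jf|Jf]; [tauto|right].
    assert (H' : cl Q ((X ∖ J) ∪ {[e]}) f).
    { apply cl_exch; [|exact Hn]. revert H. apply cl_mono. sets. }
    revert H'. apply cl_mono. sets.
  - intros S e HS He. destruct (classic (J e)) as [Je|Je]; [tauto|].
    destruct He as [He|He]; [tauto|]. right.
    assert (FS : free Q (S ∖ J)).
    { intros s [Hs HJ] Hc. apply (HS s Hs). right. revert Hc. apply cl_mono. sets. }
    generalize (cl_fund Q FS He). apply cl_mono. intros s [[Hs HJ] Hc].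
    split; [split; [exact Hs|]|exact HJ]. intros [H|H]; [tauto|].
    apply Hc. revert H. apply cl_mono. sets.
  - intros Z X HZ HZX.
    assert (HJ : forall z, Z z -> ~ J z) by (intros z Hz HJz; apply (HZ z Hz); tauto).
    destruct (cl_base Q (Z := Z) (X := X ∖ J)) as [Y [HY1 [HY2 [FY SY]]]].
    { intros z Hz Hc. apply (HZ z Hz). right. revert Hc. apply cl_mono. sets. }
    { sets. }
    exists Y. split; [exact HY1|]. split; [intros x Hx; apply HY2 in Hx; tauto|]. split.
    + intros y Hy [H|H]; [apply HY2 in Hy; tauto|].
      apply (FY y Hy). revert H. apply cl_mono. sets.
    + intros x Hx. destruct (classic (J x)) as [Jx|Jx]; [tauto|]. right.
      generalize (SY x (conj Hx Jx)). apply cl_mono. intros y Hy.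
      split; [exact Hy|]. apply HY2 in Hy. tauto.
Defined.

End Space.

(** * Packings and hindrances *)

Section Packing.
Context {E : Type}.
Implicit Types (P Q : space E) (A B K S T V W X Y Z : E -> Prop) (e f h : E).

Definition packing P Q W A B : Prop :=
  A ⊆ W /\ B ⊆ W /\ (forall x, A x -> ~ B x) /\ W ⊆ cl P A /\ W ⊆ cl Q B.

Definition hindrance P Q W A B h : Prop :=
  packing P Q W A B /\ W h /\ ~ A h /\ ~ B h.

Definition unhindered P Q : Prop := forall W A B h, ~ hindrance P Q W A B h.

Definition in_wave P Q e : Prop := exists W A B, packing P Q W A B /\ W e.

Lemma packing_sym P Q W A B : packing P Q W A B -> packing Q P W B A.
Proof. unfold packing. firstorder. Qed.

Lemma unhindered_sym P Q : unhindered P Q -> unhindered Q P.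
Proof.
  intros H W A B h [Hp Hh]. apply (H W B A h). split; [|tauto].
  apply packing_sym; exact Hp.
Qed.

(** Packed sets merge along a sequence: each contributes the part of its two spanning sets that lies
    outside the earlier ones. One packed set per element suffices, so countability provides the
    sequence. *)
Lemma max_packing P Q (f : E -> nat) : (forall x y, f x = f y -> x = y) ->
  exists A B, packing P Q (in_wave P Q) A B.
Proof.
  intro Hf.
  assert (H : forall n, exists t : (E -> Prop) * (E -> Prop) * (E -> Prop),
    packing P Q (fst (fst t)) (snd (fst t)) (snd t) /\
    forall x, f x = n -> in_wave P Q x -> fst (fst t) x).
  { intro n. destruct (classic (exists x, f x = n /\ in_wave P Q x)) as [[x [Hx [W [A [B [HW Wx]]]]]]|Hn].
    - exists (W, A, B). split; [exact HW|]. intros y Hy _. replace y with x; [exact Wx|].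
      apply Hf. congruence.
    - exists (fun _ => False, fun _ => False, fun _ => False). split; [unfold packing; cbn; firstorder|].
      intros x Hx Hw. apply Hn. exists x. auto. }
  apply functional_choice in H. destruct H as [t Ht].
  pose (W := fun n => fst (fst (t n))). pose (A := fun n => snd (fst (t n))).
  pose (B := fun n => snd (t n)).
  assert (HW : forall n, packing P Q (W n) (A n) (B n)) by (intro n; apply Ht).
  assert (HW' : forall x, in_wave P Q x -> W (f x) x) by (intros x Hx; apply Ht; auto).
  assert (HWw : forall n x, W n x -> in_wave P Q x).
  { intros n x Hx. exists (W n), (A n), (B n). auto. }
  assert (HA : forall n x, A n x -> W n x) by (intros n x Hx; apply (proj1 (HW n) x Hx)).
  assert (HB : forall n x, B n x -> W n x) by (intros n x Hx; apply (proj1 (proj2 (HW n)) x Hx)).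
  exists (fun x => exists n, A n x /\ forall m, m < n -> ~ W m x),
    (fun x => exists n, B n x /\ forall m, m < n -> ~ W m x).
  unfold packing. split; [|split; [|split; [|split]]].
  - intros x [n [Hx _]]. apply (HWw n). auto.
  - intros x [n [Hx _]]. apply (HWw n). auto.
  - intros x [n [Hn Hn']] [m [Hm Hm']].
    destruct (lt_eq_lt_dec n m) as [[Hl|Hl]|Hl].
    + apply (Hm' n Hl). auto.
    + subst m. destruct (HW n) as [_ [_ [H _]]]. apply (H x); assumption.
    + apply (Hn' m Hl). auto.
  - intros x Hx. apply HW' in Hx. revert Hx. generalize (f x) as n. intro n. revert x.
    induction n as [n IH] using lt_wf_ind. intros x Hx.
    destruct (HW n) as [_ [_ [_ [H _]]]]. generalize (H x Hx). apply cl_trans.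
    intros y Hy. destruct (classic (exists m, m < n /\ W m y)) as [[m [Hm Hy']]|Hn].
    + exact (IH m Hm y Hy').
    + apply cl_in. exists n. split; [exact Hy|]. intros m Hm Hy'. apply Hn. exists m. auto.
  - intros x Hx. apply HW' in Hx. revert Hx. generalize (f x) as n. intro n. revert x.
    induction n as [n IH] using lt_wf_ind. intros x Hx.
    destruct (HW n) as [_ [_ [_ [_ H]]]]. generalize (H x Hx). apply cl_trans.
    intros y Hy. destruct (classic (exists m, m < n /\ W m y)) as [[m [Hm Hy']]|Hn].
    + exact (IH m Hm y Hy').
    + apply cl_in. exists n. split; [exact Hy|]. intros m Hm Hy'. apply Hn. exists m. auto.
Qed.

Lemma unhindered_partition P Q W A B x : unhindered P Q -> packing P Q W A B ->
  W x -> A x \/ B x.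
Proof.
  intros H HW Hx. apply NNPP. intro Hn. apply (H W A B x). split; [exact HW|]. tauto.
Qed.

(** * Exchange walks *)

(* A configuration [A, B, h] has [h] to spare.  A step trades [h] for an element
   [s] of its fundamental circuit in [A] or in [B]; walks stop on reaching [Z]. *)
Inductive walk P Q Z A0 B0 h0 : (E -> Prop) -> (E -> Prop) -> E -> Prop :=
  | walk_nil : walk P Q Z A0 B0 h0 A0 B0 h0
  | walk_left A B h s : walk P Q Z A0 B0 h0 A B h -> ~ Z h ->
      A s -> ~ cl P (A ∖ {[s]}) h ->
      walk P Q Z A0 B0 h0 ((A ∖ {[s]}) ∪ {[h]}) B s
  | walk_right A B h s : walk P Q Z A0 B0 h0 A B h -> ~ Z h ->
      B s -> ~ cl Q (B ∖ {[s]}) h ->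
      walk P Q Z A0 B0 h0 A ((B ∖ {[s]}) ∪ {[h]}) s.

Definition exchange_cfg P Q A0 B0 h0 A B h : Prop :=
  free P A /\ free Q B /\ (forall x, A x -> ~ B x) /\ ~ A h /\ ~ B h /\
  (forall x, A x \/ B x \/ x = h <-> A0 x \/ B0 x \/ x = h0) /\
  A ⊆ cl P A0 /\ A0 ⊆ cl P A /\ B ⊆ cl Q B0 /\ B0 ⊆ cl Q B.

Lemma free_swap P A h s : free P A -> A s -> ~ A h -> ~ cl P (A ∖ {[s]}) h -> 
  free P ((A ∖ {[s]}) ∪ {[h]}).
Proof.
  intros FA As Ah Hc. apply free_add; [|exact Hc]. apply (free_subset P _ A FA). sets.
Qed.

Lemma swap_back P A h s : A s -> cl P A h -> ~ cl P (A ∖ {[s]}) h ->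
  A ⊆ cl P ((A ∖ {[s]}) ∪ {[h]}).
Proof.
  intros As Hh Hc x Ax. destruct (classic (x = s)) as [->|Hx]; [|apply cl_in; tauto].
  apply cl_exch; [|exact Hc]. revert Hh. apply cl_mono. sets.
Qed.

Lemma swap_sub P A h s : cl P A h -> ((A ∖ {[s]}) ∪ {[h]}) ⊆ cl P A.
Proof. intros Hh x [Hx| ->]; [apply cl_in; tauto|exact Hh]. Qed.

Lemma subset_cl_trans P X Y W : X ⊆ cl P Y -> Y ⊆ cl P W -> X ⊆ cl P W.
Proof. intros H1 H2 x Hx. apply (cl_trans P Y); auto. Qed.

(** Outside Z the spare element is spanned on both sides, so each step trades along an actual
    circuit and leaves both closures unchanged. *)
Lemma walk_cfg P Q Z A0 B0 h0 A B h :
  free P A0 -> free Q B0 -> (forall x, A0 x -> ~ B0 x) -> ~ A0 h0 -> ~ B0 h0 ->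
  (forall x, A0 x \/ B0 x \/ x = h0 -> Z x \/ (cl P A0 x /\ cl Q B0 x)) ->
  walk P Q Z A0 B0 h0 A B h -> exchange_cfg P Q A0 B0 h0 A B h.
Proof.
  intros FA FB HAB HhA HhB Hcl Hw. induction Hw as
    [|A B h s Hw IH HZ As Hc|A B h s Hw IH HZ Bs Hc].
  - unfold exchange_cfg. repeat split; auto; try tauto; intros x Hx; apply cl_in; exact Hx.
  - destruct IH as [FA' [FB' [D [Ah [Bh [U [C1 [C2 [C3 C4]]]]]]]]].
    assert (Hh : cl P A h).
    { destruct (Hcl h) as [?|[H _]]; [apply U; tauto|tauto|].
      revert H. apply cl_trans. exact C2. }
    unfold exchange_cfg. split; [apply free_swap; auto|]. split; [exact FB'|].
    split; [intros x [Hx| ->]; [apply D; tauto|exact Bh]|].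
    split; [intros [Hs| ->]; tauto|]. split; [apply D; exact As|]. split.
    { intro x. rewrite <- U. destruct (classic (x = s)) as [->|]; [tauto|]. 
      destruct (classic (x = h)) as [->|]; tauto. }
    split; [apply (subset_cl_trans P _ A); [apply swap_sub; exact Hh|exact C1]|].
    split; [apply (subset_cl_trans P _ A); [exact C2|apply swap_back; auto]|]. auto.
  - destruct IH as [FA' [FB' [D [Ah [Bh [U [C1 [C2 [C3 C4]]]]]]]]].
    assert (Hh : cl Q B h).
    { destruct (Hcl h) as [?|[_ H]]; [apply U; tauto|tauto|].
      revert H. apply cl_trans. exact C4. }
    unfold exchange_cfg. split; [exact FA'|]. split; [apply free_swap; auto|].
    split; [intros x Hx [Hx'| ->]; [apply (D x); tauto|auto]|].
    split; [intro Hs; apply (D s); auto|]. split; [intros [Hs| ->]; tauto|]. split.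
    { intro x. rewrite <- U. destruct (classic (x = s)) as [->|]; [tauto|]. 
      destruct (classic (x = h)) as [->|]; tauto. }
    split; [exact C1|]. split; [exact C2|].
    split; [apply (subset_cl_trans Q _ B); [apply swap_sub; exact Hh|exact C3]|].
    apply (subset_cl_trans Q _ B); [exact C4|apply swap_back; auto].
Qed.

(* One exchange step leaves the closure of the part of [A] inside [K]
   unchanged, because the fundamental circuit used lies in [K]. *)
Lemma swap_inside P A K h s : free P A -> cl P A h -> A s -> K s -> K h ->
  ~ cl P (A ∖ {[s]}) h -> (forall t, A t -> ~ cl P (A ∖ {[t]}) h -> K t) ->
  (A ∩ K) ⊆ cl P (((A ∖ {[s]}) ∪ {[h]}) ∩ K) /\
  (((A ∖ {[s]}) ∪ {[h]}) ∩ K) ⊆ cl P (A ∩ K).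
Proof.
  intros FA Hh As Ks Kh Hc HK. pose proof (cl_fund P FA Hh) as HD. split.
  - intros x [Ax Kx]. destruct (classic (x = s)) as [->|Hx]; [|apply cl_in; tauto].
    assert (H : cl P (((fun t => A t /\ ~ cl P (A ∖ {[t]}) h) ∖ {[s]}) ∪ {[h]}) s).
    { apply cl_exch.
      - revert HD. apply cl_mono. sets.
      - intro H. apply Hc. revert H. apply cl_mono. sets. }
    revert H. apply cl_mono. intros y [[[Hy Hy'] Hys]| ->]; [|tauto].
    split; [tauto|]. auto.
  - intros x [[[Hx Hxs]| ->] Kx]; [apply cl_in; tauto|].
    revert HD. apply cl_mono. intros t [Ht Ht']. auto.
Qed.

(* If no walk reaches [Z], the elements that become spare along walks form a
   hindrance. *)
Lemma walk_or_hindrance P Q Z A0 B0 h0 :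
  free P A0 -> free Q B0 -> (forall x, A0 x -> ~ B0 x) -> ~ A0 h0 -> ~ B0 h0 ->
  (forall x, A0 x \/ B0 x \/ x = h0 -> Z x \/ (cl P A0 x /\ cl Q B0 x)) ->
  (exists A B h, exchange_cfg P Q A0 B0 h0 A B h /\ Z h) \/
  (exists K, K h0 /\ (forall x, K x -> ~ Z x) /\
     (forall x, K x -> A0 x \/ B0 x \/ x = h0) /\
     K ⊆ cl P (A0 ∩ K) /\ K ⊆ cl Q (B0 ∩ K)).
Proof.
  intros FA FB HAB HhA HhB Hcl.
  assert (Hcfg := fun A B h => walk_cfg P Q Z A0 B0 h0 A B h FA FB HAB HhA HhB Hcl).
  destruct (classic (exists A B h, walk P Q Z A0 B0 h0 A B h /\ Z h))
    as [[A [B [h [Hw Hz]]]]|Hn].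
  { left. exists A, B, h. auto. }
  right. pose (K := fun h => exists A B, walk P Q Z A0 B0 h0 A B h).
  assert (KZ : forall x, K x -> ~ Z x).
  { intros x [A [B Hw]] Hz. apply Hn. exists A, B, x. auto. }
  assert (Hcl' : forall A B h, walk P Q Z A0 B0 h0 A B h -> cl P A h /\ cl Q B h).
  { intros A B h Hw. destruct (Hcfg _ _ _ Hw) as [_ [_ [_ [_ [_ [U [_ [C2 [_ C4]]]]]]]]].
    destruct (Hcl h) as [Hz|[H1 H2]]; [apply U; tauto| |].
    { exfalso. apply (KZ h); [exists A, B; exact Hw|exact Hz]. }
    split; [apply (cl_trans P A0)|apply (cl_trans Q B0)]; auto. }
  assert (HKP : forall A B h, walk P Q Z A0 B0 h0 A B h ->
    forall t, A t -> ~ cl P (A ∖ {[t]}) h -> K t).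
  { intros A B h Hw t At Ht. eexists _, _. eapply walk_left; eauto.
    apply KZ. exists A, B. exact Hw. }
  assert (HKQ : forall A B h, walk P Q Z A0 B0 h0 A B h ->
    forall t, B t -> ~ cl Q (B ∖ {[t]}) h -> K t).
  { intros A B h Hw t Bt Ht. eexists _, _. eapply walk_right; eauto.
    apply KZ. exists A, B. exact Hw. }
  assert (Hinv : forall A B h, walk P Q Z A0 B0 h0 A B h ->
    (A ∩ K) ⊆ cl P (A0 ∩ K) /\ (B ∩ K) ⊆ cl Q (B0 ∩ K)).
  { intros A B h Hw. induction Hw as [|A B h s Hw IH HZ As Hc|A B h s Hw IH HZ Bs Hc].
    - split; intros x Hx; apply cl_in; exact Hx.
    - destruct IH as [I1 I2]. split; [|exact I2].
      apply (subset_cl_trans P _ (A ∩ K)); [|exact I1].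
      destruct (Hcfg _ _ _ Hw) as [F _]. destruct (Hcl' _ _ _ Hw) as [C _].
      apply swap_inside; auto; [eapply HKP; eauto|exists A, B; exact Hw|intros t; apply HKP with B; exact Hw].
    - destruct IH as [I1 I2]. split; [exact I1|].
      apply (subset_cl_trans Q _ (B ∩ K)); [|exact I2].
      destruct (Hcfg _ _ _ Hw) as [_ [F _]]. destruct (Hcl' _ _ _ Hw) as [_ C].
      apply swap_inside; auto;
        [eapply HKQ; eauto|exists A, B; exact Hw|intros t; apply HKQ with A; exact Hw]. }
  exists K. split; [exists A0, B0; constructor|]. split; [exact KZ|]. split.
  { intros x [A [B Hw]]. destruct (Hcfg _ _ _ Hw) as [_ [_ [_ [_ [_ [U _]]]]]]. apply U. tauto. }
  split; intros x [A [B Hw]].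
  - destruct (Hcfg _ _ _ Hw) as [F _]. destruct (Hcl' _ _ _ Hw) as [C _].
    apply (cl_trans P (A ∩ K)); [apply (Hinv _ _ _ Hw)|].
    generalize (cl_fund P F C). apply cl_mono. intros t [Ht Ht']. split; [exact Ht|].
    exact (HKP _ _ _ Hw t Ht Ht').
  - destruct (Hcfg _ _ _ Hw) as [_ [F _]]. destruct (Hcl' _ _ _ Hw) as [_ C].
    apply (cl_trans Q (B ∩ K)); [apply (Hinv _ _ _ Hw)|].
    generalize (cl_fund Q F C). apply cl_mono. intros t [Ht Ht']. split; [exact Ht|].
    exact (HKQ _ _ _ Hw t Ht Ht').
Qed.

End Packing.

(** * Committing elements *)

Section Commit.
Context {E : Type}.
Implicit Types (P Q : space E) (A B K S T V W X Y Z : E -> Prop) (e f h : E).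

Lemma unhindered_mono P Q Q' : (forall X e, cl Q X e -> cl Q' X e) ->
  unhindered P Q' -> unhindered P Q.
Proof.
  intros H HU W A B h [[HA [HB [D [HP HQ]]]] Hh]. apply (HU W A B h).
  split; [|exact Hh]. unfold packing. repeat (split; auto). intros x Hx. auto.
Qed.

Lemma unhindered_loop_union P Q S T :
  unhindered P (loop (loop Q S) T) <-> unhindered P (loop Q (S ∪ T)).
Proof.
  split; apply unhindered_mono; intros X e He; cbn in *.
  - destruct He as [He|He]; [tauto|]. destruct (classic (S e)); [tauto|].
    right. right. revert He. apply cl_mono. sets.
  - destruct He as [He|[He|He]]; [tauto|tauto|].
    right. revert He. apply cl_mono. sets.
Qed.

(** Take a hindrance of the new pair with f in W. If f is not on the P-side, putting f on the Q-side
    packs W in the old pair, so f was in a wave. Otherwise a walk from h that ends in f frees f from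
    the P-side; if there is none, the walk set is a hindrance of the old pair. *)
Lemma unhindered_loop_outside P Q f : unhindered P Q -> ~ in_wave P Q f ->
  unhindered P (loop Q {[f]}).
Proof.
  intros HU Hf W A B h [[HA [HB [D [HP HQ]]]] [Hh [HhA HhB]]].
  destruct (cl_base P (Z := fun _ => False) (X := A)) as [A1 [_ [HA1 [FA SA]]]]; [sets|sets|].
  destruct (cl_base Q (Z := fun _ => False) (X := B ∖ {[f]})) as [B1 [_ [HB1 [FB SB]]]]; [sets|sets|].
  assert (HP1 : W ⊆ cl P A1) by (apply (subset_cl_trans P _ A); assumption).
  assert (HQ1 : forall x, W x -> x <> f -> cl Q B1 x).
  { intros x Hx Hxf. destruct (HQ x Hx) as [H|H]; [tauto|]. revert H. apply cl_trans. exact SB. }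
  assert (HA1W : A1 ⊆ W) by sets. 
  assert (HB1W : B1 ⊆ W) by (intros x Hx; apply HB1 in Hx; apply HB; tauto).
  assert (D1 : forall x, A1 x -> ~ B1 x).
  { intros x Hx Hx'. apply HB1 in Hx'. apply (D x); [auto|tauto]. }
  assert (Hf1 : ~ B1 f) by (intro H; apply HB1 in H; tauto).
  assert (Ph : forall A' B', A' ⊆ W -> B' ⊆ W -> (forall x, A' x -> ~ B' x) -> ~ A' f ->
    W ⊆ cl P A' -> (forall x, W x -> x <> f -> cl Q B' x) -> W f -> False).
  { intros A' B' HA' HB' D' Hf' HP' HQ' Wf. apply Hf.
    exists W, A', (B' ∪ {[f]}). split; [|exact Wf]. unfold packing.
    split; [exact HA'|]. split; [intros x [Hx| ->]; auto|].
    split; [intros x Hx [Hx'| ->]; [apply (D' x); auto|tauto]|]. split; [exact HP'|].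
    intros x Hx. destruct (classic (x = f)) as [->|Hxf]; [apply cl_in; tauto|].
    generalize (HQ' x Hx Hxf). apply cl_mono. sets. }
  assert (hA1 : ~ A1 h) by (intro H; apply HhA; auto).
  assert (hB1 : ~ B1 h) by (intro H; apply HB1 in H; tauto).
  destruct (classic (W f)) as [Wf|Wf].
  2: { apply (HU W A1 B1 h). split; [|tauto]. unfold packing. repeat (split; auto).
       intros x Hx. apply HQ1; [exact Hx|]. intros ->. tauto. }
  destruct (classic (A1 f)) as [Af|Af]; [|exact (Ph A1 B1 HA1W HB1W D1 Af HP1 HQ1 Wf)].
  destruct (walk_or_hindrance P Q {[f]} A1 B1 h FA FB D1 hA1 hB1) as
    [[A' [B' [h' [[F1 [F2 [D' [Ah [Bh [U [C1 [C2 [C3 C4]]]]]]]]] ->]]]]|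
     [K [Kh [KZ [KU [KP KQ]]]]]].
  { intros x Hx. assert (W x) by (destruct Hx as [Hx|[Hx| ->]]; auto).
    destruct (classic (x = f)); [tauto|]. right. split; [apply HP1; auto|apply HQ1; auto]. }
  - apply (Ph A' B'); auto.
    + intros x Hx. assert (H : A1 x \/ B1 x \/ x = h) by (apply U; tauto).
      destruct H as [H|[H| ->]]; auto.
    + intros x Hx. assert (H : A1 x \/ B1 x \/ x = h) by (apply U; tauto).
      destruct H as [H|[H| ->]]; auto.
    + apply (subset_cl_trans P _ A1); assumption.
    + intros x Hx Hxf. apply (cl_trans Q B1); auto.
  - apply (HU K (A1 ∩ K) (B1 ∩ K) h). split; [|tauto]. unfold packing.
    repeat (split; auto); intros x; try tauto. intros [Hx _] [Hx' _]. apply (D1 x); auto.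
Qed.

(** A hindrance of the new pair is merged with the packing. Its Q-side may have relied on X being
    loops, but X lies in W, which the merged Q-side spans because B is disjoint from X. *)
Lemma unhindered_loop_packed P Q W A B X : unhindered P Q -> packing P Q W A B ->
  X ⊆ A -> unhindered P (loop Q X).
Proof.
  intros HU [HA [HB [D [HP HQ]]]] HX W' A' B0 h [[HA' [HB0 [D0 [HP' HQ0]]]] [Hh [HhA HhB0]]].
  pose (B' := B0 ∖ X).
  assert (HB' : B' ⊆ W') by (unfold B'; sets).
  assert (D' : forall x, A' x -> ~ B' x) by (unfold B'; firstorder).
  assert (HhB : ~ B' h) by (unfold B'; tauto).
  assert (HQ' : forall x, W' x -> X x \/ cl Q B' x) by (intros x Hx; exact (HQ0 x Hx)).
  assert (BX : forall x, B' x -> ~ X x) by (unfold B'; tauto).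
  clearbody B'. clear B0 HB0 D0 HQ0 HhB0.
  destruct (classic (W h)) as [Wh|Wh].
  - apply (HU (W ∪ W') (A' ∪ (A ∖ W')) (B' ∪ (B ∖ W')) h). split; [|tauto].
    unfold packing. split; [sets|]. split; [sets|].
    split.
    { intros x [Hx|Hx] [Hx'|Hx'];
        [apply (D' x)| |apply (fun H => proj2 Hx (HB' x H))|apply (D x)]; try tauto; sets. }
    assert (Pc : (W ∪ W') ⊆ cl P (A' ∪ (A ∖ W'))).
    { assert (H : W' ⊆ cl P (A' ∪ (A ∖ W'))).
      { intros x Hx. generalize (HP' x Hx). apply cl_mono. sets. }
      intros x [Hx|Hx]; [|auto]. generalize (HP x Hx). apply cl_trans.
      intros y Hy. destruct (classic (W' y)); [auto|apply cl_in; tauto]. }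
    split; [exact Pc|].
    assert (Bc : B ⊆ cl Q (B' ∪ (B ∖ W'))).
    { intros y Hy. destruct (classic (W' y)) as [Wy|Wy]; [|apply cl_in; tauto].
      destruct (HQ' y Wy) as [Xy|H]; [exfalso; apply (D y); auto|].
      revert H. apply cl_mono. sets. }
    assert (Wc : W ⊆ cl Q (B' ∪ (B ∖ W'))) by (apply (subset_cl_trans Q _ B); assumption).
    intros x [Hx|Hx]; [auto|]. destruct (HQ' x Hx) as [Xx|H]; [auto|].
    revert H. apply cl_mono. sets.
  - apply (HU (W ∪ W') (A ∪ (A' ∖ W)) (B ∪ (B' ∖ W)) h).
    split; [|split; [tauto|]; split; intros [H|H];
      [apply Wh|apply HhA|apply Wh|apply HhB]; try tauto; auto].
    unfold packing. split; [sets|]. split; [sets|].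
    split.
    { intros x [Hx|Hx] [Hx'|Hx'];
        [apply (D x)| |apply (proj2 Hx)|apply (D' x)]; try tauto; auto; sets. }
    split.
    + assert (H : W ⊆ cl P (A ∪ (A' ∖ W))).
      { intros x Hx. generalize (HP x Hx). apply cl_mono. sets. }
      intros x [Hx|Hx]; [auto|]. generalize (HP' x Hx). apply cl_trans.
      intros y Hy. destruct (classic (W y)); [auto|apply cl_in; tauto].
    + assert (H : W ⊆ cl Q (B ∪ (B' ∖ W))).
      { intros x Hx. generalize (HQ x Hx). apply cl_mono. sets. }
      intros x [Hx|Hx]; [auto|]. destruct (HQ' x Hx) as [Xx|Hc]; [auto|].
      revert Hc. apply cl_trans.
      intros y Hy. destruct (classic (W y)); [auto|apply cl_in; tauto].
Qed.

(** * Feasible sets: those S whose commitment leaves the pair unhindered *)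

Lemma feasible_free P Q S : unhindered P (loop Q S) -> free P S.
Proof.
  intros HU s Hs Hc. apply (HU S (S ∖ {[s]}) (fun _ => False) s).
  split; [|tauto]. unfold packing. repeat (split; [sets|]). split.
  - intros x Hx. destruct (classic (x = s)) as [->|]; [exact Hc|apply cl_in; tauto].
  - intros x Hx. left. exact Hx.
Qed.

Lemma feasible_free_rest P Q S : unhindered P (loop Q S) -> free Q (cl P S ∖ S).
Proof.
  intros HU s [Hs Hs'] Hc.
  apply (HU (cl P S) S ((cl P S ∖ S) ∖ {[s]}) s).
  split; [|tauto]. unfold packing. split; [intros x Hx; apply cl_in; exact Hx|].
  split; [sets|]. split; [sets|]. split; [sets|].
  intros x Hx. cbn. destruct (classic (S x)) as [Sx|Sx]; [tauto|]. right.
  apply (cl_mono Q (X := (cl P S ∖ S) ∖ {[s]})); [sets|].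
  destruct (classic (x = s)) as [->|]; [exact Hc|apply cl_in; tauto].
Qed.

(** The hypotheses describe a packing of P/V and Q/(V ∖ S) off V, where V is [cl P S]. Adding S to
    one side and V ∖ S to the other lifts it to the committed pair. *)
Lemma feasible_quotient P Q S W A B h : unhindered P (loop Q S) ->
  (forall x, W x -> ~ cl P S x) -> A ⊆ W -> B ⊆ W -> (forall x, A x -> ~ B x) ->
  W ⊆ cl P (cl P S ∪ A) -> W ⊆ cl Q ((cl P S ∖ S) ∪ B) -> W h -> A h \/ B h.
Proof.
  intros HU HWV HA HB D HP HQ Wh. apply NNPP. intro Hn.
  assert (HSV : S ⊆ cl P S) by (intros x Hx; apply cl_in; exact Hx).
  apply (HU (cl P S ∪ W) (S ∪ A) ((cl P S ∖ S) ∪ B) h).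
  split.
  2: { split; [tauto|]. pose proof (HWV h Wh). specialize (HSV h). tauto. }
  unfold packing. split; [intros x [Hx|Hx]; auto|]. split; [intros x [Hx|Hx]; [tauto|auto]|].
  split.
  { intros x [Hx|Hx] [Hx'|Hx']; [tauto|apply (HWV x); auto| |].
    - specialize (HWV x). specialize (HA x). tauto.
    - specialize (D x). tauto. }
  split.
  - assert (H : cl P S ⊆ cl P (S ∪ A)) by (intro x; apply cl_mono; sets).
    intros x [Hx|Hx]; [auto|]. generalize (HP x Hx). apply cl_trans.
    intros y [Hy|Hy]; [auto|apply cl_in; tauto].
  - intros x Hx. cbn. destruct (classic (S x)) as [Sx|Sx]; [tauto|]. right.
    apply (cl_mono Q (X := (cl P S ∖ S) ∪ B)).
    { intros y [Hy|Hy]; [tauto|]. split; [tauto|]. intro Sy. apply (HWV y); auto. }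
    destruct Hx as [Hx|Hx]; [apply cl_in; tauto|auto].
Qed.

(* Inside [cl P S] the pair is rigid, since [S] and [cl P S ∖ S] are free and [S]
   consists of loops; a walk leaving [cl P S] yields a hindrance of the quotient. *)
Lemma feasible_intro P Q S : free P S -> free Q (cl P S ∖ S) ->
  (forall W A B h, (forall x, W x -> ~ cl P S x) -> A ⊆ W -> B ⊆ W ->
    (forall x, A x -> ~ B x) -> W ⊆ cl P (cl P S ∪ A) ->
    W ⊆ cl Q ((cl P S ∖ S) ∪ B) -> W h -> A h \/ B h) ->
  unhindered P (loop Q S).
Proof.
  intros FS FT Hquot W A B h [[HA [HB [D [HP HQ]]]] [Wh [Ah Bh]]].
  set (V := cl P S) in *.
  assert (HSV : S ⊆ V) by (intros x Hx; apply cl_in; exact Hx).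
  (* The hindrance is enlarged to contain V: missing elements go to the P-side if they lie in S and
     to the Q-side otherwise, and h stays spare. *)
  pose (W1 := W ∪ V). pose (A1 := A ∪ (S ∖ W)). pose (B1 := (B ∖ S) ∪ ((V ∖ S) ∖ W)).
  assert (HP1 : W1 ⊆ cl P A1).
  { assert (H : W ⊆ cl P A1) by (intros x Hx; generalize (HP x Hx); apply cl_mono; unfold A1; sets).
    intros x [Hx|Hx]; [auto|]. revert Hx. apply cl_trans. intros y Hy.
    destruct (classic (W y)); [auto|apply cl_in; unfold A1; tauto]. }
  assert (HQ1 : W1 ⊆ cl (loop Q S) B1).
  { assert (H : W ⊆ cl (loop Q S) B1).
    { intros x Hx. destruct (HQ x Hx) as [H|H]; [left; exact H|]. right.
      revert H. apply cl_mono. unfold B1. sets. }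
    intros x [Hx|Hx]; [auto|]. destruct (classic (W x)); [auto|].
    destruct (classic (S x)); [left; auto|]. apply cl_in. unfold B1. tauto. }
  destruct (cl_base P (Z := fun _ => False) (X := A1)) as [A2 [_ [HA2 [FA SA]]]]; [sets|sets|].
  destruct (cl_base (loop Q S) (Z := fun _ => False) (X := B1)) as [B2 [_ [HB2 [FB SB]]]]; [sets|sets|].
  assert (HA2W : A2 ⊆ W1).
  { intros x Hx. apply HA2 in Hx. unfold A1 in Hx.
    destruct Hx as [Hx|Hx]; [left; auto|right; apply HSV; tauto]. }
  assert (HB2W : B2 ⊆ W1).
  { intros x Hx. apply HB2 in Hx. unfold B1 in Hx.
    destruct Hx as [Hx|Hx]; [left; apply HB; tauto|right; tauto]. }
  assert (HB2S : forall x, B2 x -> ~ S x).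
  { intros x Hx. apply HB2 in Hx. unfold B1 in Hx. tauto. }
  assert (D2 : forall x, A2 x -> ~ B2 x).
  { intros x Hx Hx'. apply HA2 in Hx. apply HB2 in Hx'. unfold A1, B1 in *.
    specialize (D x). specialize (HA x). specialize (HB x). tauto. }
  assert (A2h : ~ A2 h) by (intro H; apply HA2 in H; unfold A1 in H; tauto).
  assert (B2h : ~ B2 h) by (intro H; apply HB2 in H; unfold B1 in H; tauto).
  assert (HP2 : W1 ⊆ cl P A2) by (apply (subset_cl_trans P _ A1); assumption).
  assert (HQ2 : W1 ⊆ cl (loop Q S) B2) by (apply (subset_cl_trans (loop Q S) _ B1); assumption).
  assert (HU2 : forall x, A2 x \/ B2 x \/ x = h -> W1 x).
  { intros x [Hx|[Hx| ->]]; auto. left. exact Wh. }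
  destruct (walk_or_hindrance P (loop Q S) (∁ V) A2 B2 h FA FB D2 A2h B2h) as
    [[A' [B' [h' [[F1 [F2 [D' [Ah' [Bh' [U [C1 [C2 [C3 C4]]]]]]]]] Hh']]]]|
     [K [Kh [KZ [KU [KP KQ]]]]]].
  { intros x Hx. right. split; [apply HP2|apply HQ2]; auto. }
  - destruct (Hquot (W1 ∖ V) (A' ∖ V) (B' ∖ V) h'); try tauto.
    + intros x [Hx Hx']. split; [|exact Hx']. apply HU2, U. tauto.
    + intros x [Hx Hx']. split; [|exact Hx']. apply HU2, U. tauto.
    + intros x [Hx _] [Hx' _]. apply (D' x); auto.
    + intros x [Hx _]. assert (H : cl P A' x) by (apply (cl_trans P A2); auto).
      revert H. apply cl_mono. intros y Hy. destruct (classic (V y)); tauto.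
    + intros x [Hx HxV]. assert (H : cl (loop Q S) B' x) by (apply (cl_trans (loop Q S) B2); auto).
      destruct H as [H|H]; [exfalso; auto|].
      revert H. apply cl_mono. intros y Hy. destruct (classic (V y)); tauto.
    + split; [|exact Hh']. apply HU2, U. tauto.
  (* K stays inside V. As V ∖ S is Q-free, each element of K off S must belong to [B2]. So h is in S
     and is P-spanned by other elements of S. *)
  - assert (HKB : forall y, K y -> ~ S y -> B2 y).
    { intros y Ky Sy. destruct (KQ y Ky) as [H|H]; [tauto|]. apply NNPP. intro By.
      apply (free_not_cl Q ((B2 ∩ K) ∖ S) (V ∖ S) y FT); auto; [|intros x Hx|tauto].
      - split; [apply NNPP; exact (KZ y Ky)|exact Sy].
      - split; [apply NNPP; apply KZ; tauto|tauto]. }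
    assert (Sh : S h) by (apply NNPP; intro; apply B2h; apply HKB; auto).
    apply (free_not_cl P (A2 ∩ K) S h FS Sh); [|tauto|apply KP; exact Kh].
    intros x [Hx Kx]. apply NNPP. intro Sx. apply (D2 x Hx). apply HKB; auto.
Qed.

(** [cl P S] is always packed in the committed pair, by S and the rest; here it is the largest
    packed set. Hence any element outside it can be committed next, by [unhindered_loop_outside]. *)
Definition nice P Q S : Prop := forall e, in_wave P (loop Q S) e -> cl P S e.

(** S' is the P-side of a packing of the largest packed set; it contains S, as an element of S
    missing from it could be spared. The last clause is what keeps the new elements independent in
    the dual, see [good_extension]. *)
Lemma nice_extension P Q S (f : E -> nat) : (forall x y, f x = f y -> x = y) ->
  unhindered P (loop Q S) ->
  exists S', S ⊆ S' /\ unhindered P (loop Q S') /\ nice P Q S' /\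
    (S' ∖ S) ⊆ cl Q (cl P S' ∖ S').
Proof.
  intros Hf HU. destruct (max_packing P (loop Q S) f Hf) as [A [B HW]].
  set (W := in_wave P (loop Q S)) in *.
  assert (HW' := HW). destruct HW' as [HA [HB [D [HP HQ]]]].
  assert (HSW : S ⊆ W).
  { intros s Hs. exists {[s]}, {[s]}, (fun _ => False). split; [|reflexivity].
    unfold packing. repeat (split; [sets|]). split; [intros x Hx; apply cl_in; exact Hx|].
    intros x ->. left. exact Hs. }
  assert (HSA : S ⊆ A).
  { intros s Hs. apply NNPP. intro As. apply (HU W A (B ∖ S) s). split; [|sets].
    unfold packing. split; [exact HA|]. split; [sets|]. split; [firstorder|]. split; [exact HP|].
    intros x Hx. destruct (HQ x Hx) as [H|H]; [left; exact H|right].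
    revert H. apply cl_mono. sets. }
  exists A. split; [exact HSA|]. split; [|split].
  - apply (unhindered_mono P _ (loop (loop Q S) A)).
    + intros X e [He|He]; [left; exact He|]. right. right. revert He. apply cl_mono. sets.
    + apply (unhindered_loop_packed P _ W A B); auto. sets.
  - intros e [W' [A' [B' [[HA' [HB' [D' [HP' HQ']]]] We]]]]. apply HP.
    exists (W ∪ W'), (A ∪ (A' ∖ W)), (B ∪ (B' ∖ W)). split; [|tauto].
    unfold packing. split; [sets|]. split; [sets|].
    split.
    { intros x [Hx|Hx] [Hx'|Hx'];
        [apply (D x)| |apply (proj2 Hx)|apply (D' x)]; try tauto; auto; sets. }
    assert (HP1 : W ⊆ cl P (A ∪ (A' ∖ W))).
    { intros x Hx. generalize (HP x Hx). apply cl_mono. sets. }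
    assert (HQ1 : W ⊆ cl (loop Q S) (B ∪ (B' ∖ W))).
    { intros x Hx. generalize (HQ x Hx). apply cl_mono. sets. }
    split.
    + intros x [Hx|Hx]; [auto|]. generalize (HP' x Hx). apply cl_trans.
      intros y Hy. destruct (classic (W y)); [auto|apply cl_in; tauto].
    + intros x [Hx|Hx]; [auto|]. destruct (HQ' x Hx) as [Ax|Hc]; [auto|].
      apply (cl_trans (loop Q S) (B' ∖ A)).
      * intros y Hy. destruct (classic (W y)); [auto|apply cl_in; tauto].
      * right. revert Hc. apply cl_mono. sets.
  - intros x [Ax Sx]. destruct (HQ x (HA x Ax)) as [H|H]; [tauto|].
    revert H. apply cl_mono. intros y [By _]. split; [apply HP; auto|].
    intro Ay. apply (D y); auto.
Qed.

End Commit.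

(** * Spanning one element *)

(** A direct sum decomposition, expressed by closures. *)
Definition splits {E : Type} (Q : space E) (A : E -> Prop) : Prop :=
  (forall X e, cl Q X e -> A e -> cl Q (X ∩ A) e) /\
  (forall X e, cl Q X e -> ~ A e -> cl Q (X ∖ A) e).

Definition finitary_at {E : Type} (Q : space E) (e : E) : Prop :=
  forall X, cl Q X e -> exists F, finite_set F /\ F ⊆ X /\ cl Q F e.

Lemma dual_splits (E : Type) (Q : space E) (A : E -> Prop) :
  splits Q A -> splits (dual Q) A.
Proof.
  intros [H1 H2]. split; intros X e He Ae;
    (destruct (classic (X e)) as [Xe|Xe]; [apply cl_in; tauto|]);
    apply dual_not in He; try exact Xe; apply dual_not; try tauto; intro Hc; apply He.
  - generalize (H1 _ _ Hc Ae). apply cl_mono. sets.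
  - generalize (H2 _ _ Hc Ae). apply cl_mono. sets.
Qed.

Section Spanning.
Context {E : Type} (P Q : space E) (A : E -> Prop) (f : E -> nat).
Hypothesis Hf : forall x y, f x = f y -> x = y.
Hypothesis HA : splits Q A.
Implicit Types (K R S T U V W X Y Z : E -> Prop) (e h s t x y : E).

Local Notation N := (dual Q).

Let HN : splits N A := dual_splits E Q A HA.

(* Q is only required to be dual to a finitary space on [A].  Off [A] the elements
   that P does not yet span are contracted in N, i.e. deleted in Q. *)
Definition outside S : E -> Prop := fun x => ~ A x /\ ~ cl P S x.

Definition good S : Prop :=
  unhindered P (loop Q S) /\ nice P Q S /\
  forall s, S s -> ~ cl N ((S ∖ {[s]}) ∪ outside S) s.

Definition initial (n : nat) : E -> Prop := fun x => A x /\ f x < n.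

(* The elements reached by exchange walks from the unspanned elements in the
   N-closure of [S] and the first [n] elements of [A]. *)
Inductive reach (n : nat) S : E -> Prop :=
  | reach_source y : cl N (S ∪ outside S ∪ initial n) y ->
      ~ cl N (S ∪ outside S) y -> reach n S y
  | reach_left y s : reach n S y -> S s -> cl P S y ->
      ~ cl P (S ∖ {[s]}) y -> reach n S s
  | reach_right s t : reach n S s -> S s -> cl N (S ∪ outside S) t ->
      ~ cl N ((S ∖ {[s]}) ∪ outside S) t -> reach n S t.

Definition le_on R S S' : Prop :=
  (forall x, R x -> (S x <-> S' x)) /\ cl P S ⊆ cl P S' /\
  ((S ∖ R) ∪ outside S) ⊆ cl N ((S' ∖ R) ∪ outside S').

(** Off A, inside [cl P S], the set S and its rest are complementary bases of N/[outside S] and Q: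
    freeness of the rest gives spanning by S here, and freeness of S gives spanning by the rest in
    [basis_dual_spanned]. *)
Lemma rest_spanned S v : free Q (cl P S ∖ S) -> cl P S v -> ~ A v ->
  cl N (S ∪ outside S) v.
Proof.
  intros FT Vv Av. destruct (classic (S v)) as [Sv|Sv]; [apply cl_in; tauto|].
  apply NNPP. intro Hn. apply not_dual in Hn. apply (proj2 HA) in Hn; [|exact Av].
  apply (FT v (conj Vv Sv)). revert Hn. apply cl_mono. unfold outside. sets.
Qed.

Lemma basis_dual_spanned S v : (forall s, S s -> ~ cl N ((S ∖ {[s]}) ∪ outside S) s) ->
  cl P S v -> ~ A v -> cl Q ((cl P S ∖ S) ∖ A) v.
Proof.
  intros gS Vv Av. destruct (classic (S v)) as [Sv|Sv]; [|apply cl_in; tauto].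
  pose proof (gS v Sv) as Hn. apply not_dual in Hn. apply (proj2 HA) in Hn; [|exact Av].
  revert Hn. apply cl_mono. unfold outside. sets.
Qed.

(** Each t in the Q-fundamental circuit of k in the rest has k in its own N-fundamental circuit in
    S, so it is reached from k by [reach_right]. *)
Lemma reach_dual_spanned n S k : good S -> reach n S k -> S k -> ~ A k ->
  cl Q ((reach n S ∖ S) ∖ A) k.
Proof.
  intros [HU [_ gS]] Rk Sk Ak. assert (FT := feasible_free_rest P Q S HU).
  assert (Hk : cl Q ((cl P S ∖ S) ∖ A) k) by (apply basis_dual_spanned; auto; apply cl_in; auto).
  assert (FTA : free Q ((cl P S ∖ S) ∖ A)) by (apply (free_subset Q _ _ FT); sets).
  generalize (cl_fund Q FTA Hk). apply cl_mono. intros t [[[Vt St] At] Ht].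
  split; [|exact At]. split; [|exact St].
  apply (reach_right n S k); auto; [apply rest_spanned; auto|].
  apply dual_disjoint with (X := (((cl P S ∖ S) ∖ A) ∖ {[t]}) ∪ {[k]}).
  - apply cl_exch; [|exact Ht]. revert Hk. apply cl_mono. sets.
  - unfold outside. intros x [Hx| ->] [Hx'|Hx']; try tauto.
    apply (proj2 Hx'). apply cl_in. exact Sk.
  - intros [Ht'| ->]; tauto.
  - unfold outside. tauto.
Qed.

Lemma reach_spanned n S : good S -> reach n S ⊆ cl P S ->
  reach n S ⊆ cl P (S ∩ reach n S).
Proof.
  intros [HU _] HV y Ry. pose proof (feasible_free P Q S HU) as FS.
  generalize (cl_fund P FS (HV y Ry)). apply cl_mono. intros s [Ss Hs].
  split; [exact Ss|]. apply (reach_left n S y); auto.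
Qed.

Lemma basis_free S : (forall s, S s -> ~ cl N ((S ∖ {[s]}) ∪ outside S) s) ->
  free (contract N (outside S)) S.
Proof. intros gS s Ss. exact (gS s Ss). Qed.

Lemma not_reach_spanned n S t : good S -> cl N (S ∪ outside S) t -> ~ reach n S t ->
  cl N ((S ∖ reach n S) ∪ outside S) t.
Proof.
  intros [_ [_ gS]] Ht Rt.
  pose proof (cl_fund (contract N (outside S)) (basis_free S gS) Ht) as H.
  cbn [cl contract] in H. revert H. apply (cl_mono N). intros s [[Ss Hs]|Us]; [left|right; exact Us].
  split; [exact Ss|]. intro Rs. apply Rt. apply (reach_right n S s); auto.
Qed.

Lemma spanned_mono R S S' x : le_on R S S' -> cl N (S ∪ outside S) x ->
  cl N (S' ∪ outside S') x.
Proof.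
  intros [Hag [_ HL]]. apply cl_trans. intros y Hy.
  destruct (classic (R y /\ S y)) as [[Ry Sy]|Hn].
  - apply cl_in. left. apply Hag; auto.
  - apply (cl_mono N (X := (S' ∖ R) ∪ outside S')); [sets|]. apply HL. tauto.
Qed.

Lemma le_on_trans R R' S S' S'' : le_on R S S' -> le_on R' S' S'' -> R ⊆ R' ->
  le_on R S S''.
Proof.
  intros [H1 [H2 H3]] [H1' [H2' H3']] HR. split; [|split].
  - intros x Rx. rewrite (H1 x Rx). apply H1'. auto.
  - intros x Hx. auto.
  - intros x Hx. generalize (H3 x Hx). apply cl_trans. intros y Hy.
    destruct (classic (R' y /\ S' y /\ ~ R y)) as [[Ry [Sy Ry']]|Hn].
    + apply cl_in. left. split; [apply H1'; auto|exact Ry'].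
    + apply (cl_mono N (X := (S'' ∖ R') ∪ outside S'')); [intros z; specialize (HR z); tauto|].
      apply H3'. tauto.
Qed.

Lemma le_on_refl R S : le_on R S S.
Proof.
  split; [tauto|]. split; [intros x Hx; exact Hx|]. intros x Hx. apply cl_in. exact Hx.
Qed.

Lemma reach_level n S : reach n S ⊆ reach (Datatypes.S n) S.
Proof.
  intros y Hy. induction Hy as [y H1 H2|y s _ IH H1 H2 H3|s t _ IH H1 H2 H3].
  - apply reach_source; [|exact H2]. revert H1. apply cl_mono. unfold initial.
    intros x [Hx|[Ax Hx]]; [tauto|]. right. split; [exact Ax|lia].
  - apply (reach_left _ S y); auto.
  - apply (reach_right _ S s); auto.
Qed.

Lemma reach_mono n S S' : good S -> good S' -> le_on (reach n S) S S' ->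
  (forall x, cl N (S ∪ outside S ∪ initial n) x -> ~ cl N (S ∪ outside S) x ->
    ~ cl N (S' ∪ outside S') x) ->
  reach n S ⊆ reach n S'.
Proof.
  intros GS GS' HL Hper.
  assert (Hr : forall y, reach n S y -> reach n S y /\ reach n S' y); [|intros y Hy; apply Hr; exact Hy].
  intros y Hy. split; [exact Hy|].
  induction Hy as [y H1 H2|y s Ry IH Ss Vy Hc|s t Rs IH Ss Ht Hc].
  - apply reach_source; [|apply Hper; auto]. revert H1. apply cl_trans.
    intros x [Hx|Hx]; [|apply cl_in; tauto].
    apply (cl_mono N (X := S' ∪ outside S')); [sets|].
    apply (spanned_mono (reach n S) S S' x HL). apply cl_in. exact Hx.
  - assert (Rs : reach n S s) by (apply (reach_left n S y); auto).
    destruct HL as [Hag [HV _]].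
    assert (Ss' : S' s) by (apply Hag; auto).
    apply (reach_left n S' y); auto. intro Hc'.
    pose proof (feasible_free P Q S (proj1 GS)) as FS.
    apply (feasible_free P Q S' (proj1 GS') s Ss').
    pose proof (cl_fund P FS Vy) as HC.
    assert (H : cl P (((fun t => S t /\ ~ cl P (S ∖ {[t]}) y) ∖ {[s]}) ∪ {[y]}) s).
    { apply cl_exch.
      - revert HC. apply cl_mono. sets.
      - intro H. apply Hc. revert H. apply cl_mono. sets. }
    revert H. apply cl_trans. intros t [[[St Ht] Hts]| ->]; [|exact Hc'].
    apply cl_in. split; [|exact Hts]. apply Hag; [|exact St]. apply (reach_left n S y); auto.
  - pose proof HL as [Hag [HV HL']].
    assert (Ss' : S' s) by (apply Hag; auto).
    apply (reach_right n S' s); auto; [apply (spanned_mono _ S S' t HL); exact Ht|].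
    intro Hc'. destruct GS as [_ [_ gS]]. destruct GS' as [_ [_ gS']].
    apply (gS' s Ss'). set (M := contract N (outside S)).
    pose proof (cl_fund M (basis_free S gS) Ht) as HC.
    assert (H : cl M (((fun k => S k /\ ~ cl M (S ∖ {[k]}) t) ∖ {[s]}) ∪ {[t]}) s).
    { apply cl_exch.
      - revert HC. apply cl_mono. sets.
      - intro H. apply Hc. revert H. unfold M. cbn [cl contract]. apply (cl_mono N). sets. }
    unfold M in H. cbn [cl contract] in H. revert H. apply (cl_trans N).
    assert (Hsub : cl N ((S' ∖ reach n S) ∪ outside S') ⊆ cl N ((S' ∖ {[s]}) ∪ outside S')).
    { intro x. apply cl_mono. intros z [Hz|Hz]; [|tauto]. left. split; [tauto|].
      intros ->. tauto. }
    intros x [[[[Sx Hx] Hxs]| ->]|Ux]; [|exact Hc'|apply Hsub, HL'; tauto].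
    destruct (classic (reach n S x)) as [Rx|Rx]; [|apply Hsub, HL'; tauto].
    apply cl_in. left. split; [apply Hag; auto|exact Hxs].
Qed.

(** The elements added by [nice_extension] are Q-spanned by the rest, which is disjoint from S' and
    from [outside S']; by duality they create no N-dependence. *)
Lemma good_extension S : unhindered P (loop Q S) ->
  (forall s, S s -> ~ cl N ((S ∖ {[s]}) ∪ outside S) s) ->
  exists S', S ⊆ S' /\ good S'.
Proof.
  intros HU gS. destruct (nice_extension P Q S f Hf HU) as [S' [HSS [HU' [Hn Hd]]]].
  exists S'. split; [exact HSS|]. split; [exact HU'|]. split; [exact Hn|].
  assert (HV : cl P S ⊆ cl P S') by (intro x; apply cl_mono; exact HSS).
  assert (HSV : S' ⊆ cl P S') by (intros x Hx; apply cl_in; exact Hx).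
  intros s Ss' Hc. destruct (classic (S s)) as [Ss|Ss].
  - apply (gS s Ss). apply (cl_mono N (X := (S ∖ {[s]}) ∪ outside S')).
    { unfold outside. intros x Hx. specialize (HV x). tauto. }
    apply NNPP. intro Hnc. apply not_dual in Hnc.
    apply (dual_disjoint Q (fun x => ~ S' x /\ ~ outside S' x) ((S' ∖ {[s]}) ∪ outside S') s); try tauto.
    + revert Hnc. apply cl_trans. intros y [Hy Hys].
      destruct (classic (S' y)) as [Sy|Sy]; [|apply cl_in; tauto].
      apply (cl_mono Q (X := cl P S' ∖ S')); [unfold outside; sets|].
      apply Hd. split; [exact Sy|]. intro. apply Hy. tauto.
    + intros [Hx|Hx]; [tauto|]. unfold outside in Hx. specialize (HSV s). tauto.
  - apply (dual_disjoint Q (cl P S' ∖ S') ((S' ∖ {[s]}) ∪ outside S') s); try tauto.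
    + apply Hd. tauto.
    + unfold outside. tauto.
    + intros [Hx|Hx]; [tauto|]. unfold outside in Hx. specialize (HSV s). tauto.
Qed.


(* The quotient of the pair by [S1] is compared with the one by [S + g]: on [A]
   through the N-spans, off [A] because both rests have the same Q-closure. *)
Lemma exchange_feasible S S1 g : good S -> ~ cl P S g -> A g -> free P S1 ->
  cl P S1 = cl P (S ∪ {[g]}) -> free (contract N (outside S)) S1 ->
  (S ∪ {[g]}) ⊆ cl N (S1 ∪ outside S) -> unhindered P (loop Q S1).
Proof.
  intros GS Vg Ag FS1 HV1 FN1 Hsp. pose proof GS as [HU [Hnice gS]].
  assert (HUg : unhindered P (loop Q (S ∪ {[g]}))).
  { apply unhindered_loop_union. apply unhindered_loop_outside; auto. }
  assert (FT1 : free Q (cl P S1 ∖ (S ∪ {[g]}))).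
  { rewrite HV1. apply feasible_free_rest. exact HUg. }
  pose proof (feasible_free_rest P Q S HU) as FT.
  assert (HVV : cl P S ⊆ cl P S1).
  { rewrite HV1. intro x. apply cl_mono. sets. }
  set (V := cl P S) in *. set (V1 := cl P S1) in *. set (U := outside S) in *.
  assert (HSV1 : S1 ⊆ V1) by (intros x Hx; apply cl_in; exact Hx).
  assert (HSV : S ⊆ V) by (intros x Hx; apply cl_in; exact Hx).
  assert (HUA : forall x, U x -> ~ A x) by (unfold U, outside; tauto).
  assert (HUV : forall x, U x -> ~ V x) by (unfold U, outside; tauto).
  assert (HVU : forall x, ~ A x -> ~ U x -> V x) by (unfold U, outside; intros; prop).
  assert (HspA : forall x, A x -> (S ∪ {[g]}) x -> cl N S1 x).
  { intros x Ax Hx. generalize (proj1 HN _ _ (Hsp x Hx) Ax). apply cl_mono.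
    intros y [[Hy|Hy] Hy']; [exact Hy|exfalso; apply (HUA y); auto]. }
  (* [J0] and [J1] say that off A both rests inside V have full Q-closure. With [J2] and [J3] this
     makes the rest of [S1] Q-free off A. *)
  assert (J0 : (V ∖ A) ⊆ cl Q ((V ∖ S) ∖ A)).
  { intros v [Vv Av]. apply basis_dual_spanned; auto. }
  assert (J1 : (V ∖ A) ⊆ cl Q ((V ∖ S1) ∖ A)).
  { intros v [Vv Av]. destruct (classic (S1 v)) as [Sv|Sv]; [|apply cl_in; tauto].
    pose proof (FN1 v Sv) as H. cbn [cl contract] in H. apply not_dual in H.
    apply (proj2 HA) in H; [|exact Av]. revert H. apply cl_mono.
    intros y [[Hy Hyv] Ay]. specialize (HVU y). tauto. }
  assert (J2 : forall d, ((V1 ∖ V) ∖ A) d ->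
    ~ cl Q ((((V1 ∖ V) ∖ A) ∖ {[d]}) ∪ (V ∖ A)) d).
  { intros d [[Vd1 Vd] Ad] Hc.
    apply (FT1 d).
    { split; [exact Vd1|]. intros [Sd| ->]; auto. }
    revert Hc. apply cl_trans. intros y [[[[Vy1 Vy] Ay] Hyd]|Hy].
    - apply cl_in. split; [split; [exact Vy1|]|exact Hyd]. intros [Sy| ->]; auto.
    - generalize (J0 y Hy). apply cl_mono. intros z [[Vz Sz] Az].
      split; [split; [auto|]|intros ->; tauto]. intros [Sz'| ->]; tauto. }
  assert (J3 : free Q ((V ∖ S1) ∖ A)).
  { intros t [[Vt St] At]. apply (disjoint_dual Q (S1 ∪ U)).
    - apply (cl_trans N (S ∪ U)); [|apply rest_spanned; auto].
      intros y [Hy|Hy]; [apply Hsp; tauto|apply cl_in; tauto].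
    - intros y [Hy|Hy] Hy'; [tauto|]. apply (HUV y); tauto.
    - specialize (HUV t). tauto.
    - tauto. }
  assert (J4 : free Q (((V1 ∖ V) ∖ A) ∪ ((V ∖ S1) ∖ A))).
  { apply free_union; [exact J3|]. intros d Hd Hc. apply (J2 d Hd).
    revert Hc. apply cl_mono. sets. }
  assert (FT2 : free Q (V1 ∖ S1)).
  { intros t [Vt St] Hc. destruct (classic (A t)) as [At|At].
    - apply (proj1 HA) in Hc; [|exact At]. revert Hc.
      assert (H1 : cl N ((S ∪ {[g]}) ∪ ∁ V1) t).
      { destruct (classic ((S ∪ {[g]}) t)) as [Zt|Zt]; [apply cl_in; tauto|].
        pose proof (FT1 t (conj Vt Zt)) as H. apply not_cl_dual in H.
        revert H. apply cl_mono. sets. }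
      apply (disjoint_dual Q (S1 ∪ ∁ V1)).
      + generalize (proj1 HN _ _ H1 At). apply (cl_trans N).
        intros y [[Hy|Hy] Ay]; [|apply cl_in; tauto].
        generalize (HspA y Ay Hy). apply cl_mono. sets.
      + intros y Hy Hy'. tauto.
      + tauto.
      + tauto.
    - apply (proj2 HA) in Hc; [|exact At].
      apply (free_not_cl Q (((V1 ∖ S1) ∖ {[t]}) ∖ A) _ t J4); auto.
      + destruct (classic (V t)); tauto.
      + intros y Hy. destruct (classic (V y)); tauto.
      + tauto. }
  (* A packing of the quotient by [S1] becomes one of the quotient by S + g. The P-closures agree,
     so only the Q-closure has to be transported. *)
  apply feasible_intro; auto.
  fold V1. intros W B C h HWV HBW HCW D HWP HWQ Wh.
  revert HWV HWP Wh. generalize (feasible_quotient P Q (S ∪ {[g]}) W B C h HUg).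
  rewrite <- HV1. fold V1. intros Hq HWV HWP Wh. apply Hq; auto.
  intros w Ww. generalize (HWQ w Ww). intro Hw.
  destruct (classic (C w)) as [Cw|Cw]; [apply cl_in; tauto|].
  destruct (classic (A w)) as [Aw|Aw].
  - apply NNPP. intro Hn. apply not_cl_dual in Hn. apply (proj1 HN) in Hn; [|exact Aw].
    revert Hw. apply (disjoint_dual Q (S1 ∪ (fun y => ~ V1 y /\ ~ C y /\ y <> w))).
    + revert Hn. apply (cl_trans N). intros y [[Hy Hyw] Ay].
      destruct (classic ((S ∪ {[g]}) y)) as [Zy|Zy].
      * generalize (HspA y Ay Zy). apply cl_mono. sets.
      * apply cl_in. right. apply not_or_and in Hy. tauto.
    + intros y [Sy|Hy] Hy'; [|tauto]. destruct Hy' as [Hy'|Hy']; [tauto|].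
      apply (HWV y); auto.
    + specialize (HWV w Ww). specialize (HSV1 w). tauto.
    + specialize (HWV w Ww). tauto.
  - apply (proj2 HA) in Hw; [|exact Aw]. revert Hw. apply cl_trans.
    intros y [[[Vy Sy]|Cy] Ay]; [|apply cl_in; tauto].
    destruct (classic (V y)) as [Vy'|Vy'].
    + generalize (J0 y (conj Vy' Ay)). apply cl_mono. intros z [[Vz Sz] Az].
      left. split; [auto|]. intros [Sz'| ->]; tauto.
    + apply cl_in. left. split; [exact Vy|]. intros [Sy'| ->]; auto.
Qed.

(** The critical d is newly P-spanned but not in S'. If it were not N-spanned as claimed, it would
    be Q-spanned off A by the rest of S' and frozen elements of S'. The latter are Q-spanned by
    reached elements off S', so d would contradict freeness of the rest. *)
Lemma outside_spanned n S S' : good S -> unhindered P (loop Q S') ->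
  reach n S ⊆ cl P S -> cl P S ⊆ cl P S' ->
  (forall x, reach n S x -> (S x <-> S' x)) ->
  outside S ⊆ cl N ((S' ∖ reach n S) ∪ outside S').
Proof.
  intros GS HU' HRV HV Hag d [Ad Vd].
  pose proof (feasible_free_rest P Q S' HU') as FT.
  destruct (classic (cl P S' d)) as [Vd'|Vd']; [|apply cl_in; unfold outside; tauto].
  assert (Rd : ~ reach n S d) by auto.
  destruct (classic (S' d)) as [Sd|Sd]; [apply cl_in; tauto|].
  apply NNPP. intro Hn. apply not_dual in Hn. apply (proj2 HA) in Hn; [|exact Ad].
  apply (FT d (conj Vd' Sd)). revert Hn. apply cl_trans. intros y [[Hy Hyd] Ay].
  destruct (classic (S' y)) as [Sy|Sy].
  - assert (Ry : reach n S y) by (apply NNPP; tauto).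
    generalize (reach_dual_spanned n S y GS Ry (proj2 (Hag y Ry) Sy) Ay).
    apply cl_mono. intros z [[Rz Sz] Az]. split; [|intros ->; tauto].
    split; [auto|]. rewrite <- Hag; auto.
  - apply cl_in. split; [|exact Hyd]. split; [|exact Sy]. unfold outside in Hy.
    apply NNPP. tauto.
Qed.

(* An exchange walk from [x] in P/R and (N - R)^* restricted to the N-span of
   [S + x]; there the set grows exactly when the walk leaves [cl P S]. *)
Lemma augment_source n S x : good S -> reach n S ⊆ cl P S ->
  ~ cl N (S ∪ outside S) x -> ~ reach n S x ->
  (exists S', good S' /\ le_on (reach n S) S S' /\ cl N (S' ∪ outside S') x) \/
  (exists K, K x /\ K ⊆ cl P S /\
    (forall y s, K y -> S s -> ~ cl P (S ∖ {[s]}) y -> K s \/ reach n S s) /\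
    (forall s t, K s -> S s -> cl N (S ∪ outside S) t ->
      ~ cl N ((S ∖ {[s]}) ∪ outside S) t -> K t \/ reach n S t)).
Proof.
  intros GS HRV Hx HRx. pose proof GS as [HU [Hnice gS]].
  pose proof (feasible_free P Q S HU) as FS.
  pose proof (feasible_free_rest P Q S HU) as FT.
  set (R := reach n S) in *. set (V := cl P S) in *. set (U := outside S) in *.
  assert (HRS : R ⊆ cl P (S ∩ R)) by (apply reach_spanned; auto).
  assert (HSV : S ⊆ V) by (intros y Hy; apply cl_in; exact Hy).
  assert (HUV : forall y, U y -> ~ V y) by (unfold U, outside; tauto).
  (* The walk lives on Y, with R contracted in P and Z contracted in Q, that is, deleted in N. The
     set [A0] + x is a base of Y in N/U, so its complement [B0] is a base of Y in Q/Z, and x is to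
     spare. *)
  pose (Y := fun y => cl N ((S ∖ R) ∪ U ∪ {[x]}) y /\ ~ R y /\ ~ U y).
  pose (Z := fun y => ~ U y /\ ~ Y y).
  pose (A0 := S ∖ R). pose (B0 := (Y ∖ S) ∖ {[x]}).
  assert (HA0Y : A0 ⊆ Y).
  { intros y [Sy Ry]. split; [apply cl_in; tauto|]. split; [exact Ry|]. intro Uy. apply (HUV y Uy). auto. }
  assert (HxU : ~ U x) by (intro Ux; apply Hx; apply cl_in; tauto).
  assert (HxS : ~ S x) by (intro Sx; apply Hx; apply cl_in; tauto).
  assert (HxY : Y x) by (split; [apply cl_in; tauto|tauto]).
  assert (HBZ : forall y, ((S ∖ R) ∪ U ∪ {[x]}) y -> ~ B0 y /\ ~ Z y).
  { unfold B0, Z. intros y [[Hy|Hy]| ->]; [|unfold Y|]; try tauto.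
    pose proof (HA0Y y Hy). tauto. }
  assert (HYsp : forall y, Y y -> S y \/ y = x -> ~ cl N ((((S ∖ R) ∪ {[x]}) ∖ {[y]}) ∪ U) y).
  { intros y Yy [Sy| ->] Hc.
    - apply (gS y Sy). apply NNPP. intro Hn. apply Hx.
      assert (H : cl N (((S ∖ {[y]}) ∪ U) ∪ {[y]}) x).
      { apply cl_exch; [|exact Hn]. revert Hc. apply cl_mono. sets. }
      revert H. apply cl_mono. sets.
    - apply Hx. revert Hc. apply cl_mono. sets. }
  assert (HYQ : Y ⊆ cl Q (B0 ∪ Z)).
  { intros y Yy. destruct (classic (S y \/ y = x)) as [Hy|Hy].
    - pose proof (HYsp y Yy Hy) as H. apply not_dual in H. revert H. apply cl_mono.
      intros z [Hz Hzy]. unfold B0, Z. destruct (classic (Y z)) as [Yz|Yz].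
      + left. assert (~ R z) by apply Yz. tauto.
      + right. tauto.
    - apply cl_in. left. unfold B0. tauto. }
  assert (FA0 : free (contract P R) A0).
  { intros s [Ss Rs] Hc. cbn [cl contract] in Hc. apply (FS s Ss). revert Hc.
    apply (cl_trans P). intros y [[[Sy Ry] Hys]|Ry]; [apply cl_in; tauto|].
    generalize (HRS y Ry). apply cl_mono. intros z [Sz Rz]. split; [exact Sz|]. intros ->. tauto. }
  assert (FB0 : free (contract Q Z) B0).
  { intros b [[Yb Sb] bx] Hc. cbn [cl contract] in Hc. revert Hc.
    apply (disjoint_dual Q ((S ∖ R) ∪ U ∪ {[x]})).
    - apply Yb.
    - intros y Hy. specialize (HBZ y Hy). tauto.
    - unfold Y in Yb. tauto.
    - unfold Z. tauto. }
  assert (hB0 : forall y, Y y -> y = x \/ A0 y \/ B0 y).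
  { intros y Yy. assert (~ R y) by apply Yy. unfold A0, B0.
    destruct (classic (y = x)); [tauto|]. destruct (classic (S y)); tauto. }
  assert (hY0 : forall y, A0 y \/ B0 y \/ y = x -> Y y).
  { intros y [Hy|[Hy| ->]]; auto. unfold B0 in Hy. tauto. }
  destruct (walk_or_hindrance (contract P R) (contract Q Z) (∁ V) A0 B0 x) as
    [[A' [B' [g [[FA' [FB' [D' [Ag [Bg [HU' [C1 [C2 [C3 C4]]]]]]]]] Vg]]]]|
     [K [Kx [KZ [KU [KP KQ]]]]]]; auto.
  { unfold A0, B0. tauto. }
  { unfold A0. tauto. }
  { unfold B0. tauto. }
  { intros y Hy. destruct (classic (V y)) as [Vy|Vy]; [right|left; exact Vy].
    cbn [cl contract]. split; [|apply HYQ, hY0, Hy].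
    revert Vy. unfold V. apply cl_mono. intros z Sz. unfold A0. tauto. }
  - left. cbn [cl contract] in C1, C2, C3, C4.
    assert (Yg : Y g) by (apply hY0, HU'; tauto).
    (* Off A, an element not in V lies in U, which is excluded from Y. *)
    assert (Ag' : A g).
    { apply NNPP. intro Ag'. apply (proj2 (proj2 Yg)). unfold U, outside. tauto. }
    assert (HA'Y : A' ⊆ Y) by (intros y Hy; apply hY0, HU'; tauto).
    assert (HB'Y : B' ⊆ Y) by (intros y Hy; apply hY0, HU'; tauto).
    assert (HYU' : forall y, Y y -> A' y \/ B' y \/ y = g).
    { intros y Yy. apply HU'. destruct (hB0 y Yy); tauto. }
    assert (HAR : (A' ∪ (S ∩ R)) ⊆ V).
    { assert (H : (A0 ∪ R) ⊆ V) by (intros y [Hy|Hy]; [apply HSV; apply Hy|auto]).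
      intros y [Hy|[Hy _]]; [|auto]. unfold V. generalize (C1 y Hy). apply (cl_trans P). exact H. }
    assert (HVA : V ⊆ cl P (A' ∪ (S ∩ R))).
    { intros y Hy. revert Hy. unfold V. apply cl_trans. intros z Sz.
      destruct (classic (R z)) as [Rz|Rz]; [apply cl_in; tauto|].
      generalize (C2 z (conj Sz Rz)). apply (cl_trans P). intros w [Hw|Hw]; [apply cl_in; tauto|].
      generalize (HRS w Hw). apply cl_mono. sets. }
    assert (Hclg : forall y, cl P (A' ∪ (S ∩ R)) y -> V y).
    { intro y. unfold V. apply cl_trans. exact HAR. }
    pose (S1 := (A' ∪ (S ∩ R)) ∪ {[g]}).
    assert (FS1 : free P S1).
    { apply free_add; [|intro H; apply Vg; auto]. apply free_union.
      - apply (free_subset P _ S FS). sets.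
      - intros y Hy Hc. apply (FA' y Hy). cbn [cl contract]. revert Hc. apply (cl_mono P). sets. }
    assert (HV1 : cl P S1 = cl P (S ∪ {[g]})).
    { apply set_ext; intro y; apply cl_trans; intros z [Hz| ->]; try (apply cl_in; unfold S1; tauto).
      - generalize (HAR z Hz). unfold V. apply cl_mono. sets.
      - generalize (HVA z (HSV z Hz)). apply cl_mono. unfold S1. sets. }
    assert (NY : Y ⊆ cl N ((A' ∪ {[g]}) ∪ U)).
    { intros y Yy. destruct (HYU' y Yy) as [Hy|[Hy|Hy]]; [apply cl_in; tauto| |apply cl_in; tauto].
      pose proof (FB' y Hy) as H. cbn [cl contract] in H. apply not_cl_dual in H.
      revert H. apply cl_mono. intros z [Hz Hzy]. unfold Z in Hz. specialize (HYU' z).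
      cbv beta in Hz. prop. }
    assert (HSsp : S ⊆ cl N (S1 ∪ U)).
    { intros y Sy. destruct (classic (R y)) as [Ry|Ry]; [apply cl_in; unfold S1; tauto|].
      generalize (NY y (HA0Y y (conj Sy Ry))). apply cl_mono. unfold S1. sets. }
    assert (FN1 : free (contract N U) S1).
    { apply (free_subset _ _ ((S ∩ R) ∪ (A' ∪ {[g]}))); [|unfold S1; sets].
      apply free_union.
      - intros a Ha. cbn [cl contract].
        assert (Ya : Y a) by (destruct Ha as [Ha| ->]; auto).
        apply (dual_disjoint Q (B' ∪ Z)).
        + generalize (HYQ a Ya). apply cl_trans. intros y [Hy|Hy]; [|apply cl_in; tauto].
          exact (C4 y Hy).
        + intros y [Hy|Hy] [[[Hy'| ->] _]|Hy']; try tauto.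
          * apply (D' y); auto.
          * apply (proj2 (proj2 (HB'Y y Hy))). exact Hy'.
          * unfold Z in Hy. specialize (HA'Y y). tauto.
          * unfold Z in Hy. tauto.
          * unfold Z in Hy. tauto.
        + intros [Hy|Hy]; [|unfold Z in Hy; tauto].
          destruct Ha as [Ha| ->]; [apply (D' a); auto|tauto].
        + intros [Hy|Hy]; [tauto|]. exact (proj2 (proj2 Ya) Hy).
      - intros k [Sk Rk] Hc. cbn [cl contract] in Hc.
        assert (Hc' : cl N (((S ∖ {[k]}) ∪ U) ∪ {[x]}) k).
        { revert Hc. apply (cl_trans N). intros y [[[[Sy Ry] Hyk]|Hy]|Hy];
            [apply cl_in; tauto| |apply cl_in; tauto].
          assert (Yy : Y y) by (destruct Hy as [Hy| ->]; auto).
          generalize (proj1 Yy). apply cl_mono. intros z [[[Sz Rz]|Uz]|Hz]; [|tauto|tauto].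
          left. left. split; [exact Sz|]. intros ->. tauto. }
        apply Hx. assert (H : cl N (((S ∖ {[k]}) ∪ U) ∪ {[k]}) x).
        { apply cl_exch; [exact Hc'|]. exact (gS k Sk). }
        revert H. apply cl_mono. sets. }
    assert (HU1 : unhindered P (loop Q S1)).
    { apply (exchange_feasible S S1 g); auto. intros y [Sy| ->]; [apply HSsp; exact Sy|].
      apply cl_in. unfold S1. tauto. }
    assert (HVV1 : V ⊆ cl P S1).
    { intros y Vy. generalize (HVA y Vy). apply cl_mono. unfold S1. sets. }
    destruct (good_extension S1 HU1) as [S' [HS1 GS']].
    { intros s Ss Hc. apply (FN1 s Ss). cbn [cl contract]. revert Hc. apply (cl_mono N).
      intros y [Hy|Hy]; [tauto|]. right. unfold U, outside in *. specialize (HVV1 y). tauto. }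
    assert (HVV : V ⊆ cl P S').
    { intros y Vy. generalize (HVV1 y Vy). apply cl_mono. exact HS1. }
    assert (Hag : forall y, R y -> (S y <-> S' y)).
    { intros y Ry. split.
      - intro Sy. apply HS1. unfold S1. tauto.
      - intro Sy'. apply NNPP. intro Sy.
        apply (free_not_cl P (S ∩ R) S' y (feasible_free P Q S' (proj1 GS')) Sy').
        + intros z [Sz Rz]. apply HS1. unfold S1. tauto.
        + tauto.
        + apply HRS; exact Ry. }
    assert (HUs : U ⊆ cl N ((S' ∖ R) ∪ outside S')).
    { apply outside_spanned; auto. apply GS'. }
    assert (HYs : Y ⊆ cl N ((S' ∖ R) ∪ outside S')).
    { apply (subset_cl_trans N _ ((A' ∪ {[g]}) ∪ U)); [exact NY|].
      intros y [Hy|Hy]; [|auto]. apply cl_in. left.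
      split; [apply HS1; unfold S1; tauto|]. 
      assert (Yy : Y y) by (destruct Hy as [Hy| ->]; auto). apply Yy. }
    exists S'. split; [exact GS'|]. split; [split; [exact Hag|]; split; [exact HVV|]|].
    + intros y [Hy|Hy]; auto.
    + generalize (HYs x HxY). apply cl_mono. sets.
  - right. exists K. split; [exact Kx|]. cbn [cl contract] in KP, KQ.
    assert (KV : K ⊆ V) by (intros y Ky; apply NNPP; exact (KZ y Ky)).
    assert (KY : K ⊆ Y) by (intros y Ky; apply hY0; auto).
    split; [exact KV|]. split.
    + intros y s Ky Ss Hc. apply NNPP. intro Hn. apply Hc.
      generalize (KP y Ky). apply cl_trans. intros z [[Az Kz]|Rz].
      * apply cl_in. split; [apply Az|]. intros ->. tauto.
      * generalize (HRS z Rz). apply cl_mono. intros w [Sw Rw]. split; [exact Sw|]. intros ->. tauto.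
    + intros s t Ks Ss Ht Hc. destruct (classic (R t)) as [Rt|Rt]; [tauto|left].
      assert (Rs : ~ R s) by apply (KY s Ks).
      destruct (classic (t = s)) as [->|Hts]; [exact Ks|].
      assert (St : ~ S t) by (intro St; apply Hc; apply cl_in; tauto).
      assert (Ut : ~ U t) by (intro Ut; apply Hc; apply cl_in; tauto).
      assert (Htx : t <> x) by (intros ->; tauto).
      assert (HtR : cl N ((S ∖ R) ∪ U) t) by (apply not_reach_spanned; auto).
      assert (Yt : Y t).
      { split; [|tauto]. revert HtR. apply cl_mono. sets. }
      (* Without t in K, the element s would be Q-spanned by [B0] - t with Z, and N-spanned by the
         disjoint set (S ∖ R) - s + t with U, against duality. *)
      apply NNPP. intro Kt.
      apply (dual_disjoint Q ((B0 ∖ {[t]}) ∪ Z) ((((S ∖ R) ∖ {[s]}) ∪ U) ∪ {[t]}) s).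
      * generalize (KQ s Ks). apply cl_mono. intros y [[By Ky]|Zy]; [left|tauto].
        split; [exact By|]. intros ->. tauto.
      * intros y Hy [Hy'|Hy']; [specialize (HBZ y); cbv beta in HBZ; tauto|].
        subst y. unfold Z in Hy. tauto.
      * unfold B0, Z. specialize (KY s Ks). tauto.
      * intros [[Hy|Hy]|Hy]; [tauto|apply (HUV s); auto|auto].
      * apply cl_exch; [|intro H; apply Hc; revert H; apply cl_mono; sets].
        revert HtR. apply cl_mono. sets.
Qed.


(** If no source of level m can be newly spanned, [augment_source] puts each of them into
    [reach k S] or into a closed set. Both are preserved along walks and lie in [cl P S]. *)
Lemma augment k m S : good S -> reach k S ⊆ cl P S -> ~ reach m S ⊆ cl P S ->
  exists S' x, good S' /\ le_on (reach k S) S S' /\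
    cl N (S ∪ outside S ∪ initial m) x /\ ~ cl N (S ∪ outside S) x /\
    cl N (S' ∪ outside S') x.
Proof.
  intros GS HV Hm. apply NNPP. intro Hn. apply Hm.
  pose (closed K := K ⊆ cl P S /\
    (forall y s, K y -> S s -> ~ cl P (S ∖ {[s]}) y -> K s \/ reach k S s) /\
    (forall s t, K s -> S s -> cl N (S ∪ outside S) t ->
      ~ cl N ((S ∖ {[s]}) ∪ outside S) t -> K t \/ reach k S t)).
  assert (H : forall y, reach m S y -> reach k S y \/ exists K, K y /\ closed K).
  { intros y Hy. induction Hy as [y H1 H2|y s _ IH Ss Vy Hc|s t _ IH Ss Ht Hc].
    - destruct (classic (reach k S y)) as [Ry|Ry]; [tauto|right].
      destruct (augment_source k S y GS HV H2 Ry) as [[S' HS']|[K [Ky HK]]].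
      + exfalso. apply Hn. exists S', y. tauto.
      + exists K. auto.
    - destruct IH as [Ry|[K [Ky HK]]].
      + left. apply (reach_left k S y); auto.
      + destruct HK as [KV [KP KN]]. destruct (KP y s Ky Ss Hc); [right|tauto].
        exists K. unfold closed. auto.
    - destruct IH as [Rs|[K [Ks HK]]].
      + left. apply (reach_right k S s); auto.
      + destruct HK as [KV [KP KN]]. destruct (KN s t Ks Ss Ht Hc); [right|tauto].
        exists K. unfold closed. auto. }
  intros y Hy. destruct (H y Hy) as [Ry|[K [Ky [KV _]]]]; auto.
Qed.

(** * Corank, stability and the limit hindrance *)

Definition corank_le S (n r : nat) : Prop :=
  exists l, length l = r /\
    initial n ⊆ cl N ((S ∪ outside S) ∪ (fun x => In x l)).

Lemma corank_finite S n : exists r, corank_le S n r.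
Proof.
  assert (H : exists l, forall x, f x < n -> In x l).
  { induction n as [|n [l Hl]]; [exists nil; lia|].
    destruct (classic (exists x, f x = n)) as [[x Hx]|Hx].
    - exists (x :: l). intros y Hy. destruct (Nat.eq_dec (f y) n) as [Hyn|Hyn].
      + left. apply Hf. congruence.
      + right. apply Hl. lia.
    - exists l. intros y Hy. apply Hl. assert (f y <> n) by (intro; apply Hx; eauto). lia. }
  destruct H as [l Hl]. exists (length l), l. split; [reflexivity|].
  intros x [_ Hx]. apply cl_in. right. auto.
Qed.

Lemma list_exchange (M : space E) X x l : ~ cl M X x -> cl M (X ∪ (fun y => In y l)) x ->
  exists l', length l' < length l /\
    (fun y => In y l) ⊆ cl M (X ∪ {[x]} ∪ (fun y => In y l')).
Proof.
  intro Hn. induction l as [|a l IH]; intro Hx.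
  - exfalso. apply Hn. revert Hx. apply cl_mono. cbn. sets.
  - destruct (classic (cl M (X ∪ (fun y => In y l)) x)) as [Hl|Hl].
    + destruct (IH Hl) as [l' [Hl' Hsub]]. exists (a :: l'). split; [cbn; lia|].
      intros y [<-|Hy]; [apply cl_in; cbn; tauto|]. generalize (Hsub y Hy).
      apply cl_mono. cbn. sets.
    + exists l. split; [cbn; lia|]. intros y [<-|Hy]; [|apply cl_in; tauto].
      assert (H : cl M ((X ∪ (fun y => In y l)) ∪ {[x]}) a).
      { apply cl_exch; [|exact Hl]. revert Hx. apply cl_mono. cbn. sets. }
      revert H. apply cl_mono. sets.
Qed.

Lemma corank_decrease R S S' n r x : corank_le S n r -> le_on R S S' ->
  cl N (S ∪ outside S ∪ initial n) x -> ~ cl N (S ∪ outside S) x ->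
  cl N (S' ∪ outside S') x -> exists r', r' < r /\ corank_le S' n r'.
Proof.
  intros [l [Hl HD]] HL Hx Hnx Hx'.
  destruct (list_exchange N (S ∪ outside S) x l Hnx) as [l' [Hl' Hsub]].
  { revert Hx. apply cl_trans. intros y [Hy|Hy]; [apply cl_in; tauto|auto]. }
  exists (length l'). split; [lia|]. exists l'. split; [reflexivity|].
  assert (Hbase : (S ∪ outside S ∪ {[x]} ∪ (fun y => In y l')) ⊆
    cl N ((S' ∪ outside S') ∪ (fun y => In y l'))).
  { intros y [[Hy|Hy]|Hy]; [| |apply cl_in; tauto];
      apply (cl_mono N (X := S' ∪ outside S')); try (intros z; tauto).
    - apply (spanned_mono R S S' y HL). apply cl_in. exact Hy.
    - subst y. exact Hx'. }
  apply (subset_cl_trans N _ _ _ HD). intros y [Hy|Hy].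
  - apply Hbase. tauto.
  - generalize (Hsub y Hy). apply (cl_trans N). exact Hbase.
Qed.

Lemma corank_mono R S S' n r : corank_le S n r -> le_on R S S' -> corank_le S' n r.
Proof.
  intros [l [Hl HD]] HL. exists l. split; [exact Hl|].
  apply (subset_cl_trans N _ _ _ HD). intros y [Hy|Hy]; [|apply cl_in; tauto].
  apply (cl_mono N (X := S' ∪ outside S')); [sets|].
  apply (spanned_mono R S S' y HL). apply cl_in. exact Hy.
Qed.

(* Once the corank of the first [n] elements cannot be lowered further without
   changing [S] on [reach n S], no later change makes [reach n] leave the closure. *)
Definition stable n S : Prop :=
  good S /\ forall S', good S' -> le_on (reach n S) S S' ->
    (forall x, cl N (S ∪ outside S ∪ initial n) x -> ~ cl N (S ∪ outside S) x ->
      ~ cl N (S' ∪ outside S') x) /\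
    reach n S' ⊆ cl P S'.

Lemma stable_mono n S S' : stable n S -> good S' -> le_on (reach n S) S S' ->
  reach n S ⊆ reach n S'.
Proof.
  intros [GS HS] GS' HL. destruct (HS S' GS' HL) as [Hper _].
  apply reach_mono; auto.
Qed.

Lemma nat_minimum (phi : nat -> Prop) : (exists n, phi n) ->
  exists n, phi n /\ forall m, m < n -> ~ phi m.
Proof.
  intros [n Hn]. induction n as [n IH] using lt_wf_ind.
  destruct (classic (exists m, m < n /\ phi m)) as [[m [Hm Hp]]|H]; [eauto|].
  exists n. split; [exact Hn|]. intros m Hm Hp. apply H. eauto.
Qed.

(** The minimum is taken over continuations frozen only on [reach n], because [augment] may alter S
    on the next level. Either failure of stability would yield such a continuation of smaller
    corank. *)
Lemma stable_step n S : stable n S ->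
  exists S', stable (Datatypes.S n) S' /\ le_on (reach n S) S S'.
Proof.
  intro HS. set (n' := Datatypes.S n).
  destruct (nat_minimum (fun r => exists S', good S' /\ le_on (reach n S) S S' /\
    corank_le S' n' r)) as [r [[S0 [G0 [L0 C0]]] Hmin]].
  { destruct (corank_finite S n') as [r Hr]. exists r, S. split; [apply HS|].
    split; [apply le_on_refl|exact Hr]. }
  exists S0. split; [|exact L0]. split; [exact G0|]. intros S' GS' L'.
  assert (LS : le_on (reach n S) S S').
  { apply (le_on_trans _ (reach n' S0) _ S0); auto. intros x Hx.
    apply reach_level. apply (stable_mono n S S0); auto. }
  split.
  - intros x Hx Hnx Hx'.
    destruct (corank_decrease _ S0 S' n' r x C0 L' Hx Hnx Hx') as [r' [Hr' C']].
    apply (Hmin r' Hr'). exists S'. auto.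
  - apply NNPP. intro Hb.
    assert (HV : reach n S' ⊆ cl P S') by (apply HS; auto).
    destruct (augment n n' S' GS' HV Hb) as [S'' [x [GS'' [L'' [Hx [Hnx Hx'']]]]]].
    destruct (corank_decrease _ S' S'' n' r x (corank_mono _ _ _ _ _ C0 L') L'' Hx Hnx Hx'')
      as [r' [Hr' C']].
    apply (Hmin r' Hr'). exists S''. split; [exact GS''|]. split; [|exact C'].
    apply (le_on_trans _ (reach n S') _ S'); auto.
    apply stable_mono; auto.
Qed.

Hypothesis HAfin : forall e, A e -> finitary_at N e.

Theorem span_element e : unhindered P Q -> A e ->
  exists S, unhindered P (loop Q S) /\ cl N S e.
Proof.
  intros HU Ae. apply NNPP. intro Hno.
  assert (He : forall S, good S -> ~ cl N (S ∪ outside S) e).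
  { intros S GS Hc. apply Hno. exists S. split; [apply GS|].
    generalize (proj1 HN _ _ Hc Ae). apply cl_mono. unfold outside. sets. }
  destruct (good_extension (fun _ => False)) as [S0 [_ G0]].
  { apply (unhindered_mono P _ Q); [|exact HU]. intros X x [Hx|Hx]; [tauto|].
    revert Hx. apply cl_mono. sets. }
  { tauto. }
  (* Level 0 has no sources, so nothing is reached. *)
  assert (St0 : stable 0 S0).
  { split; [exact G0|]. intros S' GS' _. 
    assert (H0 : forall T x, cl N (T ∪ initial 0) x -> cl N T x).
    { intros T x. apply cl_mono. unfold initial. intros y [Hy|[_ Hy]]; [exact Hy|lia]. }
    split; [intros x Hx Hnx; exfalso; apply Hnx; apply H0; exact Hx|].
    assert (Hr : forall x, ~ reach 0 S' x).
    { intros x Hx. induction Hx as [y H1 H2|y s _ IH _ _ _|s t _ IH _ _ _]; auto. }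
    intros x Hx. exfalso. exact (Hr x Hx). }
  destruct (dependent_choice _ stable (fun n S S' => le_on (reach n S) S S') S0 St0)
    as [s [_ Hs]].
  { intros n S HS. destruct (stable_step n S HS) as [S' HS']. exists S'. exact HS'. }
  pose (R := fun n => reach n (s n)).
  assert (Gs : forall n, good (s n)) by (intro n; apply (proj1 (Hs n))).
  assert (RV : forall n, R n ⊆ cl P (s n)).
  { intro n. destruct (proj1 (Hs n)) as [_ H]. apply (H (s n)); auto. apply le_on_refl. }
  assert (Rstep : forall n, R n ⊆ R (Datatypes.S n)).
  { intros n x Hx. apply reach_level. apply (stable_mono n (s n)); auto; apply Hs. }
  assert (Rmono : forall n m, n <= m -> R n ⊆ R m).
  { intros n m Hnm. induction Hnm as [|m _ IH]; [intros x Hx; exact Hx|].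
    intros x Hx. apply Rstep. auto. }
  assert (Hag : forall n m x, n <= m -> R n x -> (s n x <-> s m x)).
  { intros n m x Hnm Rx. induction Hnm as [|m Hnm IH]; [tauto|].
    rewrite IH. destruct (proj2 (Hs m)) as [H _]. apply H. apply (Rmono n m Hnm). exact Rx. }
  pose (R' := fun x => exists n, R n x). pose (S' := fun x => exists n, R n x /\ s n x).
  assert (HS' : forall n x, R n x -> (S' x <-> s n x)).
  { intros n x Rx. split.
    - intros [m [Rm Sm]]. destruct (Nat.le_ge_cases n m) as [H|H].
      + apply (Hag n m x H Rx). exact Sm.
      + apply (Hag m n x H Rm). exact Sm.
    - intro Sx. exists n. auto. }
  pose (B := fun x => R' x /\ ~ S' x /\ x <> e).
  assert (Re : R (Datatypes.S (f e)) e).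
  { apply reach_source; [|apply He; auto]. apply cl_in. right. split; [exact Ae|lia]. }
  assert (Se : ~ S' e).
  { intro H. apply (HS' _ _ Re) in H. apply (He (s (Datatypes.S (f e)))); auto.
    apply cl_in. tauto. }
  (* An element of A that is never reached is no source at any level above its index, so it is
     already N-spanned there, and without using reached elements. *)
  assert (Hlate : forall z, A z -> ~ R' z -> forall m, f z < m ->
    cl N ((s m ∖ R m) ∪ outside (s m)) z).
  { intros z Az Rz m Hm. assert (Rmz : ~ R m z) by (intro; apply Rz; exists m; auto).
    apply not_reach_spanned; auto. apply NNPP. intro Hc. apply Rmz.
    apply reach_source; [|exact Hc]. apply cl_in. right. split; [exact Az|exact Hm]. }
  apply (HU R' S' B e). split; [|unfold B; split; [exists (Datatypes.S (f e)); exact Re|tauto]].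
  unfold packing. split; [intros x [n [Hx _]]; exists n; exact Hx|].
  split; [unfold B; sets|]. split; [unfold B; sets|]. split.
  { intros x [n Rx]. generalize (reach_spanned n (s n) (Gs n) (RV n) x Rx).
    apply cl_mono. intros y [Sy Ry]. exists n. auto. }
  intros y [n0 Ry0]. apply NNPP. intro Hy.
  assert (By : ~ B y) by (intro By; apply Hy; apply cl_in; exact By).
  assert (Ry' : R' y) by (exists n0; exact Ry0).
  destruct (classic (A y)) as [Ay|Ay].
  - pose proof (not_cl_dual Q B y Hy) as Hd.
    apply (proj1 HN) in Hd; [|exact Ay].
    (* The N-dependence of y uses a finite X, so one stage m exceeds all indices in X and has
       reached every element of X that is ever reached. At this stage y depends on [s m] - y,
       [outside (s m)] and e, and exchange makes e spanned. *)
    destruct (HAfin y Ay _ Hd) as [X [[l Hl] [HX Hc]]].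
    assert (Hm : exists m, n0 <= m /\ forall z, X z -> f z < m /\ (R' z -> R m z)).
    { assert (H : exists m, n0 <= m /\ forall z, In z l -> f z < m /\ (R' z -> R m z)).
      { clear Hl. induction l as [|a l [m [Hm IH]]]; [exists n0; split; [lia|intros z []]|].
        destruct (classic (R' a)) as [[k Ra]|Ra].
        - exists (m + k + f a + 1). split; [lia|]. intros z [<-|Hz].
          + split; [lia|]. intros _. apply (Rmono k); [lia|exact Ra].
          + destruct (IH z Hz) as [H1 H2]. split; [lia|]. intro Rz.
            apply (Rmono m); [lia|auto].
        - exists (m + f a + 1). split; [lia|]. intros z [<-|Hz].
          + split; [lia|]. intro; tauto.
          + destruct (IH z Hz) as [H1 H2]. split; [lia|]. intro Rz.
            apply (Rmono m); [lia|auto]. }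
      destruct H as [m [Hm H]]. exists m. split; [exact Hm|]. intros z Xz. apply H. auto. }
    destruct Hm as [m [Hm Hm']].
    assert (Ry : R m y) by (apply (Rmono n0); auto).
    assert (HXs : forall z, X z -> z <> e -> cl N ((s m ∖ {[y]}) ∪ outside (s m)) z).
    { intros z Xz Hze. destruct (HX z Xz) as [[Bz Hzy] Az]. destruct (Hm' z Xz) as [Hfz HRz].
      destruct (classic (R' z)) as [Rz|Rz].
      - apply cl_in. left. split; [|exact Hzy]. apply (HS' m z (HRz Rz)).
        apply NNPP. intro. apply Bz. unfold B. tauto.
      - generalize (Hlate z Az Rz m Hfz). apply cl_mono. intros w [Hw|Hw]; [left|tauto].
        split; [tauto|]. intros ->. tauto. }
    destruct (classic (y = e)) as [->|Hye].
    + apply (He (s m) (Gs m)). revert Hc. apply (cl_trans N). intros z Xz.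
      assert (Hze : z <> e) by (intros ->; destruct (HX e Xz); tauto).
      generalize (HXs z Xz Hze). apply cl_mono. sets.
    + assert (Sy : s m y).
      { apply (HS' m y Ry). apply NNPP. intro. apply By. unfold B. tauto. }
      pose proof (proj2 (proj2 (Gs m)) y Sy) as Hny.
      apply (He (s m) (Gs m)).
      assert (H : cl N (((s m ∖ {[y]}) ∪ outside (s m)) ∪ {[y]}) e).
      { apply cl_exch; [|exact Hny]. revert Hc. apply (cl_trans N). intros z Xz.
        destruct (classic (z = e)) as [->|Hze]; [apply cl_in; tauto|].
        generalize (HXs z Xz Hze). apply cl_mono. sets. }
      revert H. apply cl_mono. sets.
  - assert (Hye : y <> e) by (intros ->; tauto).
    assert (Sy : s n0 y).
    { apply (HS' n0 y Ry0). apply NNPP. intro. apply By. unfold B. tauto. }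
    apply Hy. generalize (reach_dual_spanned n0 (s n0) y (Gs n0) Ry0 Sy Ay).
    apply cl_mono. intros z [[Rz Sz] Az]. unfold B. split; [exists n0; exact Rz|].
    split; [|intros ->; tauto]. intro H. apply Sz. apply (HS' n0 z Rz). exact H.
Qed.

End Spanning.

(** * Coverings *)

Section Covering.
Context {E : Type}.
Implicit Types (P Q : space E) (A I J S X : E -> Prop) (e x : E).

Lemma loop_splits Q A I : splits Q A -> splits (loop Q I) A.
Proof.
  intros [H1 H2]. split; intros X e [He|He] Ae; try (left; exact He); right.
  - generalize (H1 _ _ He Ae). apply cl_mono. sets.
  - generalize (H2 _ _ He Ae). apply cl_mono. sets.
Qed.

Lemma finite_subset (X Y : E -> Prop) : finite_set Y -> X ⊆ Y -> finite_set X.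
Proof. intros [l Hl] H. exists l. auto. Qed.

Lemma loop_dual_finitary Q I e : finitary_at (dual Q) e -> finitary_at (dual (loop Q I)) e.
Proof.
  intros H X [Xe|He].
  - exists {[e]}. split; [exists (e :: nil); intros x ->; left; reflexivity|].
    split; [intros x ->; exact Xe|apply cl_in; reflexivity].
  - assert (Hd : cl (dual Q) (X ∪ I) e).
    { right. intro Hc. apply He. right. revert Hc. apply cl_mono. sets. }
    destruct (H _ Hd) as [F [HF [HFX Hc]]]. exists (F ∖ I). split; [|split].
    + apply (finite_subset _ F HF). sets.
    + intros x [Fx Ix]. destruct (HFX x Fx); tauto.
    + assert (Ie : ~ I e) by (intro; apply He; left; exact H0).
      destruct Hc as [Fe|Hc]; [left; tauto|]. right. intros [Hc'|Hc']; [tauto|].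
      apply Hc. revert Hc'. apply cl_mono. sets.
Qed.

(** In the dual of [loop Q I] the set I is contracted, so spanning e there by S means spanning it by
    I ∪ S in the dual of Q. *)
Lemma span_element_loop P Q A I (f : E -> nat) e : (forall x y, f x = f y -> x = y) ->
  splits Q A -> (forall x, A x -> finitary_at (dual Q) x) ->
  unhindered P (loop Q I) -> A e ->
  exists I', I ⊆ I' /\ unhindered P (loop Q I') /\ cl (dual Q) I' e.
Proof.
  intros Hf HA Hfin HU Ae.
  destruct (span_element P (loop Q I) A f Hf (loop_splits Q A I HA)) with (e := e)
    as [S [HS Hc]]; auto.
  { intros x Ax. apply loop_dual_finitary. auto. }
  exists (I ∪ S). split; [sets|]. split; [apply unhindered_loop_union; exact HS|].
  destruct Hc as [Hc|Hc]; [left; tauto|]. right. intro H. apply Hc. right.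
  revert H. apply cl_mono. sets.
Qed.

(** In a packing of an unhindered pair no element is spare, so e sits on one side and may be
    committed there. *)
Lemma unhindered_decide P Q e : unhindered P Q ->
  unhindered P (loop Q {[e]}) \/ unhindered (loop P {[e]}) Q.
Proof.
  intro HU. destruct (classic (in_wave P Q e)) as [[W [A [B [HW We]]]]|Hn].
  - destruct (unhindered_partition P Q W A B e HU HW We) as [Ae|Be]; [left|right].
    + apply (unhindered_loop_packed P Q W A B); auto. intros x ->. exact Ae.
    + apply unhindered_sym. apply (unhindered_loop_packed Q P W B A).
      * apply unhindered_sym. exact HU.
      * apply packing_sym. exact HW.
      * intros x ->. exact Be.
  - left. apply unhindered_loop_outside; auto.
Qed.

Lemma unhindered_loop_union_left P Q S T :
  unhindered (loop (loop P S) T) Q -> unhindered (loop P (S ∪ T)) Q.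
Proof.
  intro H. apply unhindered_sym. apply unhindered_loop_union. apply unhindered_sym. exact H.
Qed.

Lemma unhindered_disjoint P Q I J x : unhindered (loop P J) (loop Q I) -> I x -> ~ J x.
Proof.
  intros HU Ix Jx. apply (HU {[x]} (fun _ => False) (fun _ => False) x).
  split; [|tauto]. unfold packing. split; [sets|]. split; [sets|]. split; [tauto|].
  split; intros y ->; left; assumption.
Qed.

(** On A, a set I n that dually spans e is disjoint from all J n, so their union without e cannot
    Q-span e. Off A, a finite dependence would already show at some stage. *)
Lemma limit_free P Q A (I J : nat -> E -> Prop) (f : E -> nat) :
  (forall e, ~ A e -> finitary_at Q e) ->
  (forall n, unhindered (loop P (J n)) (loop Q (I n))) ->
  (forall n, I n ⊆ I (S n)) -> (forall n, J n ⊆ J (S n)) ->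
  (forall e, A e -> cl (dual Q) (I (S (f e))) e) ->
  free Q (fun x => exists n, J n x).
Proof.
  intros Hfin HU HI HJ Hsp j [n Jn] Hc.
  assert (mono : forall K : nat -> E -> Prop, (forall n, K n ⊆ K (S n)) ->
    forall n m, n <= m -> K n ⊆ K m).
  { intros K HK a b Hab. induction Hab as [|b _ IH]; intros x Hx; [exact Hx|apply HK; auto]. }
  assert (D : forall n m x, J n x -> I m x -> False).
  { intros a b x Ja Ib. apply (unhindered_disjoint P Q (I (a + b)) (J (a + b)) x (HU _)).
    - apply (mono I HI b); [lia|exact Ib].
    - apply (mono J HJ a); [lia|exact Ja]. }
  destruct (classic (A j)) as [Aj|Aj].
  - destruct (Hsp j Aj) as [Hj|Hj]; [exact (D _ _ _ Jn Hj)|].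
    apply Hj. revert Hc. apply cl_mono. intros x [[m Jm] Hx]. split; [|exact Hx].
    intro Ix. exact (D _ _ _ Jm Ix).
  - destruct (Hfin j Aj _ Hc) as [F [[l Hl] [HF HFc]]].
    assert (Hm : exists m, forall x, In x l -> F x -> J m x).
    { clear Hl. induction l as [|a l [m IH]]; [exists 0; intros x []|].
      destruct (classic (F a)) as [Fa|Fa].
      - destruct (HF a Fa) as [[k Ja] _]. exists (m + k). intros x [<-|Hx] Fx.
        + apply (mono J HJ k); [lia|exact Ja].
        + apply (mono J HJ m); [lia|auto].
      - exists m. intros x [<-|Hx] Fx; [tauto|auto]. }
    destruct Hm as [m Hm].
    pose proof (feasible_free _ _ _ (unhindered_sym _ _ (HU (m + n)))) as FJ.
    apply (FJ j); [apply (mono J HJ n); [lia|exact Jn]|]. right.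
    revert HFc. apply cl_mono. intros x Fx. destruct (HF x Fx) as [_ Hxj].
    assert (Jx : J (m + n) x) by (apply (mono J HJ m); [lia|auto]).
    split; [split; [exact Jx|exact Hxj]|]. intro Ix. exact (D _ _ _ Jx Ix).
Qed.

Theorem unhindered_cover P Q A B (f : E -> nat) : (forall x y, f x = f y -> x = y) ->
  splits P A -> (forall e, A e -> finitary_at (dual P) e) ->
  (forall e, ~ A e -> finitary_at P e) ->
  splits Q B -> (forall e, B e -> finitary_at (dual Q) e) ->
  (forall e, ~ B e -> finitary_at Q e) ->
  unhindered P Q -> exists I, free P I /\ free Q (∁ I).
Proof.
  intros Hf HA HA1 HA2 HB HB1 HB2 HU.
  destruct (dependent_choice ((E -> Prop) * (E -> Prop))
    (fun _ t => unhindered (loop P (snd t)) (loop Q (fst t)))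
    (fun n t t' => fst t ⊆ fst t' /\ snd t ⊆ snd t' /\ forall e, f e = n ->
      (B e -> cl (dual Q) (fst t') e) /\ (A e -> cl (dual P) (snd t') e) /\
      (fst t' e \/ snd t' e)) (fun _ => False, fun _ => False)) as [s [_ Hs]].
  { assert (H : forall Q', forall X x, cl (loop Q' (fun _ => False)) X x -> cl Q' X x).
    { intros Q' X x [Hx|Hx]; [tauto|]. revert Hx. apply cl_mono. sets. }
    apply (unhindered_mono _ _ Q); [apply H|]. apply unhindered_sym.
    apply (unhindered_mono _ _ P); [apply H|]. apply unhindered_sym. exact HU. }
  { intros n [I J] HIJ. cbn [fst snd] in *.
    destruct (classic (exists e, f e = n)) as [[e He]|Hn].
    2: { exists (I, J). cbn [fst snd]. split; [exact HIJ|]. split; [sets|]. split; [sets|].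
         intros e He. exfalso. eauto. }
    assert (H1 : exists I1, I ⊆ I1 /\ unhindered (loop P J) (loop Q I1) /\
      (B e -> cl (dual Q) I1 e)).
    { destruct (classic (B e)) as [Be|Be]; [|exists I; split; [sets|tauto]].
      destruct (span_element_loop (loop P J) Q B I f e) as [I1 HI1]; auto.
      exists I1. tauto. }
    destruct H1 as [I1 [HI1 [HU1 HB']]].
    assert (H2 : exists J1, J ⊆ J1 /\ unhindered (loop P J1) (loop Q I1) /\
      (A e -> cl (dual P) J1 e)).
    { destruct (classic (A e)) as [Ae|Ae]; [|exists J; split; [sets|tauto]].
      destruct (span_element_loop (loop Q I1) P A J f e) as [J1 HJ1]; auto.
      { apply unhindered_sym. exact HU1. }
      exists J1. split; [tauto|]. split; [apply unhindered_sym; tauto|tauto]. }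
    destruct H2 as [J1 [HJ1 [HU2 HA']]].
    destruct (unhindered_decide _ _ e HU2) as [H|H].
    - exists (I1 ∪ {[e]}, J1). cbn [fst snd].
      split; [apply unhindered_loop_union; exact H|]. split; [sets|]. split; [exact HJ1|].
      intros e' He'. replace e' with e by (apply Hf; congruence).
      split; [intro Be; generalize (HB' Be); apply cl_mono; sets|]. tauto.
    - exists (I1, J1 ∪ {[e]}). cbn [fst snd].
      split; [apply unhindered_loop_union_left; exact H|]. split; [exact HI1|]. split; [sets|].
      intros e' He'. replace e' with e by (apply Hf; congruence).
      split; [tauto|]. split; [intro Ae; generalize (HA' Ae); apply cl_mono; sets|]. tauto. }
  pose (I := fun n => fst (s n)). pose (J := fun n => snd (s n)).
  assert (HIJ : forall n, unhindered (loop P (J n)) (loop Q (I n))) by (intro n; apply Hs).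
  assert (HI : forall n, I n ⊆ I (S n)) by (intro n; apply Hs).
  assert (HJ : forall n, J n ⊆ J (S n)) by (intro n; apply Hs).
  exists (fun x => exists n, I n x). split.
  - apply (limit_free Q P A J I f); auto.
    + intro n. apply unhindered_sym. apply HIJ.
    + intros e Ae. apply (proj2 (Hs (f e))); auto.
  - apply (free_subset Q _ (fun x => exists n, J n x)).
    + apply (limit_free P Q B I J f); auto.
      intros e Be. apply (proj2 (Hs (f e))); auto.
    + intros x Hx. destruct (proj2 (Hs (f x))) as [_ [_ H]].
      destruct (H x eq_refl) as [_ [_ [HIx|HJx]]]; [|exists (S (f x)); exact HJx].
      exfalso. apply Hx. exists (S (f x)). exact HIx.
Qed.

End Covering.

(** * Matroids as closure spaces *)

Section MatroidSpace.
Context {E : Type} (M : matroid E).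
Implicit Types (I J K S X Y Z C : E -> Prop) (e f x y s : E).

Definition maximal_within X K : Prop := maximal_in (fun L => indep M L /\ L ⊆ X) K.

Lemma maximal_in_union_base I B : base_of (indep M) B ->
  maximal_within (I ∪ B) I -> base_of (indep M) I.
Proof.
  intros HB [[HI _] Hmax]. apply NNPP. intro Hn.
  destruct (indep_aug E M I B HI Hn HB) as [e [Be [Ie He]]].
  apply Ie. apply (Hmax (I ∪ {[e]})); [|sets|tauto].
  split; [exact He|]. intros x [Hx| ->]; tauto.
Qed.

(** Axiom (3) passes to restrictions. If J offers nothing to I, extend J to a base B, and I within I
    ∪ B to a base I', which meets X in I only. Another base L contains some g of X and loses some d
    off X. Then T lies in B and misses d, so L augments T, necessarily by an element of X, against
    maximality of J. *)
Lemma augment_within X I J : indep M I -> I ⊆ X -> ~ maximal_within X I ->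
  maximal_within X J -> exists e, J e /\ ~ I e /\ indep M (I ∪ {[e]}).
Proof.
  intros HI HIX HnI [[HJ HJX] HJmax]. apply NNPP. intro Hno.
  destruct (indep_max E M (fun _ => True) J HJ) as [B [HJB [[HB _] HBmax]]]; [sets|].
  assert (BB : base_of (indep M) B).
  { split; [exact HB|]. intros L HL. apply HBmax. split; [exact HL|sets]. }
  assert (HBX : forall x, B x -> X x -> J x).
  { intros x Bx Xx. apply (HJmax (B ∩ X)); [|intros y Jy; split; auto|tauto].
    split; [apply (indep_subset E M _ B HB); sets|sets]. }
  assert (Hext : forall L, indep M L -> I ⊆ L -> L ⊆ X -> exists L',
    L ⊆ L' /\ base_of (indep M) L' /\ L' ⊆ (L ∪ B)).
  { intros L HL HIL HLX. destruct (indep_max E M (L ∪ B) L HL) as [L' [HLL [[HL' HLB] Hm]]]; [sets|].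
    exists L'. split; [exact HLL|]. split; [|exact HLB].
    apply (maximal_in_union_base L' B BB). split; [split; [exact HL'|sets]|].
    intros L'' [HL'' Hs] HL1. apply Hm; [|exact HL1]. split; [exact HL''|].
    intros x Hx. destruct (Hs x Hx) as [H|H]; [auto|tauto]. }
  destruct (Hext I HI) as [I' [HII [BI HIB]]]; [sets|exact HIX|].
  assert (HI'X : forall x, I' x -> X x -> I x).
  { intros x Hx Xx. destruct (HIB x Hx) as [H|H]; [exact H|]. apply NNPP. intro Ix.
    apply Hno. exists x. split; [auto|]. split; [exact Ix|].
    apply (indep_subset E M _ I'); [apply BI|]. intros y [Hy| ->]; auto. }
  assert (Hf : exists g, X g /\ ~ I g /\ indep M (I ∪ {[g]})).
  { apply NNPP. intro Hng. apply HnI. split; [tauto|]. intros L [HL HLX] HIL x Lx.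
    apply NNPP. intro Ix. apply Hng. exists x. split; [auto|]. split; [exact Ix|].
    apply (indep_subset E M _ L HL). intros y [Hy| ->]; auto. }
  destruct Hf as [g [Xg [Ig Hg]]].
  destruct (indep_max E M (I' ∪ {[g]}) (I ∪ {[g]}) Hg) as [L [HgL [[HL HLI] HLmax]]].
  { intros x [Hx| ->]; auto. }
  assert (Lg : L g) by (apply HgL; tauto).
  assert (I'g : ~ I' g) by (intro; apply Ig; auto).
  assert (BL : base_of (indep M) L).
  { apply (maximal_in_union_base L I' BI). split; [split; [exact HL|sets]|].
    intros L' [HL' Hs] HLL. apply HLmax; [|exact HLL]. split; [exact HL'|].
    intros x Hx. destruct (Hs x Hx) as [H|H]; [auto|tauto]. }
  assert (Hd : exists d, I' d /\ ~ L d).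
  { apply NNPP. intro Hn. apply I'g. apply (proj2 BI L HL); [|exact Lg].
    intros x Hx. apply NNPP. intro Lx. apply Hn. exists x. auto. }
  destruct Hd as [d [I'd Ld]].
  assert (Xd : ~ X d).
  { intro Xd. apply Ld, HgL. left. auto. }
  pose (T := J ∪ (L ∖ X)).
  assert (HTB : T ⊆ B).
  { intros x [Hx|[Lx Xx]]; [auto|]. destruct (HLI x Lx) as [H| ->]; [|tauto].
    destruct (HIB x H) as [Ix|Bx]; [exfalso; auto|exact Bx]. }
  assert (Hd' : B d) by (destruct (HIB d I'd) as [Id|Bd]; [exfalso; auto|exact Bd]).
  destruct (indep_aug E M T L) as [y [Ly [Ty Hy]]]; [apply (indep_subset E M _ B HB HTB)| |exact BL|].
  { intros [_ Hm]. assert (Td : T d) by (apply (Hm B HB HTB); exact Hd').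
    destruct Td as [Jd|[Ld' _]]; auto. }
  unfold T in Ty, Hy. assert (Xy : X y) by (apply NNPP; tauto).
  apply Ty. left. apply (HJmax (J ∪ {[y]})); [|sets|tauto].
  split; [apply (indep_subset E M _ _ Hy); sets|]. intros x [Hx| ->]; auto.
Qed.

Lemma exists_maximal Z X : indep M Z -> Z ⊆ X -> exists K, Z ⊆ K /\ maximal_within X K.
Proof. intros HZ HZX. exact (indep_max E M X Z HZ HZX). Qed.

(** Dependent extensions stand in for circuits, whose existence is derived later from fundamental
    circuits ([circuit_exists]). *)
Definition matroid_cl X : E -> Prop :=
  fun e => X e \/ exists I, I ⊆ X /\ indep M I /\ ~ indep M (I ∪ {[e]}).

Lemma maximal_within_dep X K e : maximal_within X K -> X e -> ~ K e -> ~ indep M (K ∪ {[e]}).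
Proof.
  intros [[HK HKX] Hm] Xe Ke Hc. apply Ke. apply (Hm (K ∪ {[e]})); [|sets|tauto].
  split; [exact Hc|]. intros x [Hx| ->]; auto.
Qed.

Lemma maximal_add X K e : maximal_within X K -> indep M (K ∪ {[e]}) ->
  maximal_within (X ∪ {[e]}) (K ∪ {[e]}).
Proof.
  intros [[HK HKX] Hm] He. split; [split; [exact He|sets]|].
  intros L [HL HLX] HKL x Lx. destruct (HLX x Lx) as [Xx| ->]; [|tauto].
  left. apply (Hm (L ∩ X)); [|intros y Ky; split; auto|tauto].
  split; [apply (indep_subset E M _ L HL); sets|sets].
Qed.

Lemma matroid_cl_maximal X K e : maximal_within X K -> ~ X e ->
  (matroid_cl X e <-> ~ indep M (K ∪ {[e]})).
Proof.
  intros HK Xe. split.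
  - intros [He|[I [HIX [HI Hd]]]]; [tauto|]. intro Hc.
    destruct (exists_maximal I X HI HIX) as [I1 [HII HI1]].
    assert (Hd1 : ~ indep M (I1 ∪ {[e]})).
    { intro H. apply Hd. apply (indep_subset E M _ _ H). sets. }
    assert (HI2 : maximal_within (X ∪ {[e]}) I1).
    { split; [split; [apply HI1|intros x Hx; left; apply HI1; exact Hx]|].
      intros L [HL HLX] HIL. assert (Le : ~ L e).
      { intro Le. apply Hd1. apply (indep_subset E M _ L HL). intros x [Hx| ->]; auto. }
      apply HI1; [|exact HIL]. split; [exact HL|]. intros x Lx.
      destruct (HLX x Lx) as [H| ->]; tauto. }
    destruct (augment_within (X ∪ {[e]}) K I1) as [y [Iy [Ky Hy]]]; auto.
    + apply HK.
    + intros x Hx. left. apply HK. exact Hx.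
    + intros [_ Hm]. apply Xe. apply HK. apply (Hm (K ∪ {[e]})); [|sets|tauto].
      split; [exact Hc|]. intros x [Hx| ->]; [left; apply HK; exact Hx|tauto].
    + apply (maximal_within_dep X K y HK); auto. apply HI1. exact Iy.
  - intro H. right. exists K. split; [apply HK|]. split; [apply HK|exact H].
Qed.

Lemma matroid_cl_mono X Y e : X ⊆ Y -> matroid_cl X e -> matroid_cl Y e.
Proof.
  intros H [He|[I [HI Hd]]]; [left; auto|right]. exists I. split; [sets|exact Hd].
Qed.

Lemma matroid_cl_idem X e : matroid_cl (matroid_cl X) e -> matroid_cl X e.
Proof.
  intro He. destruct (classic (matroid_cl X e)) as [H|Hn]; [exact H|].
  destruct (exists_maximal (fun _ => False) X (indep_empty E M)) as [K [_ HK]]; [sets|].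
  assert (HKc : maximal_within (matroid_cl X) K).
  { split; [split; [apply HK|intros x Hx; left; apply HK; exact Hx]|].
    intros L [HL HLX] HKL x Lx. apply NNPP. intro Kx.
    assert (Hx : indep M (K ∪ {[x]})).
    { apply (indep_subset E M _ L HL). intros y [Hy| ->]; auto. }
    destruct (classic (X x)) as [Xx|Xx]; [exact (maximal_within_dep X K x HK Xx Kx Hx)|].
    exact (proj1 (matroid_cl_maximal X K x HK Xx) (HLX x Lx) Hx). }
  right. exists K. split; [apply HK|]. split; [apply HK|].
  exact (proj1 (matroid_cl_maximal _ K e HKc Hn) He).
Qed.

Lemma indep_free S : indep M S <-> free_in matroid_cl S.
Proof.
  split.
  - intros HS s Ss [H|[I [HI [_ Hd]]]]; [tauto|]. apply Hd. apply (indep_subset E M _ S HS).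
    intros x [Hx| ->]; [apply HI; exact Hx|exact Ss].
  - intro FS. destruct (exists_maximal (fun _ => False) S (indep_empty E M)) as [K [_ HK]]; [sets|].
    apply (indep_subset E M _ K); [apply HK|]. intros s Ss. apply NNPP. intro Ks.
    apply (FS s Ss). right. exists K. split.
    + intros x Hx. split; [apply HK; exact Hx|]. intros ->. tauto.
    + split; [apply HK|]. apply (maximal_within_dep S K s HK); auto.
Qed.

Lemma indep_maximal S : indep M S -> maximal_within S S.
Proof. intro HS. split; [split; [exact HS|sets]|]. intros L [_ HL] _. exact HL. Qed.

Lemma matroid_cl_exch X e f : matroid_cl (X ∪ {[f]}) e -> ~ matroid_cl X e ->
  matroid_cl (X ∪ {[e]}) f.
Proof.
  intros He Hn. destruct (classic (f = e)) as [->|Hfe]; [left; tauto|].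
  destruct (exists_maximal (fun _ => False) X (indep_empty E M)) as [K [_ HK]]; [sets|].
  assert (Xe : ~ X e) by (intro; apply Hn; left; exact H).
  assert (Hf : ~ matroid_cl X f).
  { intro Hf. apply Hn. apply matroid_cl_idem. revert He. apply matroid_cl_mono.
    intros x [Hx| ->]; [left; exact Hx|exact Hf]. }
  assert (Xf : ~ X f) by (intro; apply Hf; left; exact H).
  assert (Ke : indep M (K ∪ {[e]})).
  { apply NNPP. intro H. apply Hn. apply (matroid_cl_maximal X K e HK Xe). exact H. }
  assert (Kf : indep M (K ∪ {[f]})).
  { apply NNPP. intro H. apply Hf. apply (matroid_cl_maximal X K f HK Xf). exact H. }
  pose proof (maximal_add X K f HK Kf) as HKf.
  assert (Hd : ~ indep M ((K ∪ {[f]}) ∪ {[e]})).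
  { apply (matroid_cl_maximal (X ∪ {[f]}) _ e HKf); [|exact He]. intros [H| ->]; tauto. }
  right. exists (K ∪ {[e]}). split; [|split; [exact Ke|]].
  - intros x [Hx| ->]; [left; apply HK; exact Hx|tauto].
  - intro H. apply Hd. apply (indep_subset E M _ _ H). sets.
Qed.

Lemma matroid_cl_fund S e : free_in matroid_cl S -> matroid_cl S e ->
  matroid_cl (fun s => S s /\ ~ matroid_cl (S ∖ {[s]}) e) e.
Proof.
  intros FS He. assert (HS := proj2 (indep_free S) FS).
  destruct (classic (S e)) as [Se|Se]; [left; auto|].
  set (D := fun s => S s /\ ~ matroid_cl (S ∖ {[s]}) e).
  assert (HD : forall s, S s -> indep M ((S ∖ {[s]}) ∪ {[e]}) -> D s).
  { intros s Ss Hi. split; [exact Ss|]. intro Hc. revert Hi.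
    apply (matroid_cl_maximal (S ∖ {[s]})); auto; [|tauto].
    apply indep_maximal. apply (indep_subset E M _ S HS). sets. }
  assert (Hd : ~ indep M (S ∪ {[e]})).
  { apply (matroid_cl_maximal S S e (indep_maximal S HS) Se). exact He. }
  right. exists D. split; [sets|]. split; [apply (indep_subset E M _ S HS); unfold D; sets|].
  intro HDe.
  destruct (exists_maximal (D ∪ {[e]}) (S ∪ {[e]}) HDe) as [J [HDJ HJ]]; [unfold D; sets|].
  assert (Je : J e) by (apply HDJ; tauto).
  assert (Hs : exists s, S s /\ ~ J s).
  { apply NNPP. intro Hn. apply Hd. apply (indep_subset E M _ J); [apply HJ|].
    intros x [Hx| ->]; [|exact Je]. apply NNPP. intro Jx. apply Hn. exists x. auto. }
  destruct Hs as [s [Ss Js]].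
  (* J misses a second element of S: if it missed s alone, S - s + e would be independent and s
     would lie in D, hence in J. *)
  assert (Hs' : exists t, S t /\ ~ J t /\ t <> s).
  { apply NNPP. intro Hn. apply Js. apply HDJ. left. apply HD; [exact Ss|].
    apply (indep_subset E M _ J); [apply HJ|]. intros x [[Sx Hxs]| ->]; [|exact Je].
    apply NNPP. intro Jx. apply Hn. exists x. auto. }
  destruct Hs' as [t [St [Jt Hts]]].
  (* I still misses t, so J augments it. The only element J can offer is e, and then J + s would be
     independent. *)
  pose (I := (J ∖ {[e]}) ∪ {[s]}).
  assert (HIS : I ⊆ S).
  { intros x [[Jx Hxe]| ->]; [|exact Ss]. destruct HJ as [[_ HJ] _].
    destruct (HJ x Jx); tauto. }
  destruct (augment_within (S ∪ {[e]}) I J) as [y [Jy [Iy Hy]]]; auto.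
  - apply (indep_subset E M _ S HS HIS).
  - intros x Hx. left. auto.
  - intros [_ Hm]. assert (It : I t) by (apply (Hm S); [split; [exact HS|sets]|exact HIS|exact St]).
    destruct It as [[H _]|H]; tauto.
  - assert (y = e) by (apply NNPP; intro; apply Iy; left; auto). subst y.
    apply (maximal_within_dep _ J s HJ); [tauto|exact Js|].
    apply (indep_subset E M _ _ Hy). unfold I. sets.
Qed.

Definition matroid_space : space E.
Proof.
  refine (Space E matroid_cl matroid_cl_mono _ matroid_cl_idem matroid_cl_exch
    matroid_cl_fund _).
  - intros X e He. left. exact He.
  - intros Z X FZ HZX. destruct (exists_maximal Z X (proj2 (indep_free Z) FZ) HZX) as [K [HZK HK]].
    exists K. split; [exact HZK|]. split; [apply HK|]. split; [apply indep_free; apply HK|].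
    intros x Xx. destruct (classic (K x)) as [Kx|Kx]; [left; exact Kx|right].
    exists K. split; [sets|]. split; [apply HK|]. apply (maximal_within_dep X K x HK Xx Kx).
Defined.

End MatroidSpace.

(** * Circuits, finitariness of minors, and the final assembly *)

Section Circuits.
Context {E : Type}.
Implicit Types (M : matroid E) (Q : space E) (A B C F I X : E -> Prop) (e x : E).

Lemma circuit_exists Q X e : cl Q X e -> ~ X e ->
  exists C, circuit_of (free Q) C /\ C e /\ C ⊆ (X ∪ {[e]}).
Proof.
  intros He Xe. destruct (cl_base Q (Z := fun _ => False) (X := X)) as [K [_ [HKX [FK SK]]]];
    [sets|sets|].
  pose proof (cl_fund Q FK (cl_trans Q X K e SK He)) as HD.
  set (D := fun s => K s /\ ~ cl Q (K ∖ {[s]}) e) in *.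
  exists (D ∪ {[e]}). split; [|split; [tauto|]].
  2: { intros x [[Kx _]| ->]; auto. }
  split.
  - intro H. apply (H e); [tauto|]. revert HD. apply cl_mono. intros x Dx.
    split; [tauto|]. intros ->. destruct Dx as [Ke _]. auto.
  - intros D' HD' Hn x Hx. apply NNPP. intro Hx'. apply Hn. destruct Hx as [[Kx Hx]| ->].
    + apply (free_subset Q _ ((K ∖ {[x]}) ∪ {[e]})).
      * apply free_add; [apply (free_subset Q _ K FK); sets|exact Hx].
      * intros y Dy. assert (y <> x) by (intros ->; tauto).
        destruct (HD' y Dy) as [[Ky _]|Hy]; tauto.
    + apply (free_subset Q _ K FK). intros y Dy.
      destruct (HD' y Dy) as [[Ky _]| ->]; tauto.
Qed.

Lemma circuit_of_iff (i j : (E -> Prop) -> Prop) C : (forall X, i X <-> j X) ->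
  circuit_of i C -> circuit_of j C.
Proof.
  intros H [H1 H2]. split; [rewrite <- H; exact H1|].
  intros D HD Hj. apply H2; [exact HD|]. rewrite H. exact Hj.
Qed.

Lemma matroid_free M I : indep M I <-> free (matroid_space M) I.
Proof. apply indep_free. Qed.

Lemma dual_indep_free M I : dual_indep M I <-> free (dual (matroid_space M)) I.
Proof.
  set (Q := matroid_space M). split.
  - intros [B [[HB Hmax] HIB]] i Ii Hc.
    assert (HBE : maximal_within M (fun _ => True) B).
    { split; [split; [exact HB|sets]|]. intros L [HL _]. apply Hmax. exact HL. }
    assert (Hd : cl Q B i).
    { right. exists B. split; [sets|]. split; [exact HB|].
      apply (maximal_within_dep M _ B i HBE); auto. }
    apply (dual_disjoint Q B (I ∖ {[i]}) i Hd); auto; [|tauto].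
    intros x Bx [Ix _]. exact (HIB x Ix Bx).
  - intro FI. destruct (cl_base Q (Z := fun _ => False) (X := ∁ I)) as [B [_ [HBI [FB SB]]]];
      [sets|sets|].
    exists B. split; [|intros x Ix Bx; exact (HBI x Bx Ix)].
    apply matroid_free in FB. split; [exact FB|]. intros L HL HBL x Lx.
    apply NNPP. intro Bx. apply matroid_free in HL. fold Q in HL.
    apply (free_not_cl Q B L x HL Lx HBL Bx). apply (cl_trans Q (∁ I)); [exact SB|].
    destruct (classic (I x)) as [Ix|Ix]; [|apply cl_in; exact Ix].
    pose proof (FI x Ix) as H. apply not_dual in H. revert H. apply cl_mono. sets.
Qed.

Lemma circuits_finitary Q A : splits Q A ->
  (forall C, circuit_of (free Q) C -> C ⊆ A -> finite_set C) ->
  forall e, A e -> finitary_at Q e.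
Proof.
  intros HA Hfin e Ae X He. destruct (classic (X e)) as [Xe|Xe].
  - exists {[e]}. split; [exists (e :: nil); intros x ->; left; reflexivity|].
    split; [intros x ->; exact Xe|apply cl_in; reflexivity].
  - destruct (circuit_exists Q (X ∩ A) e (proj1 HA _ _ He Ae)) as [C [HC [Ce HCX]]]; [tauto|].
    exists (C ∖ {[e]}). split; [|split].
    + apply (finite_subset _ C); [|sets]. apply Hfin; [exact HC|].
      intros x Cx. destruct (HCX x Cx) as [H| ->]; [tauto|exact Ae].
    + intros x [Cx Hx]. destruct (HCX x Cx); tauto.
    + apply NNPP. intro Hn. destruct HC as [HC Hmin].
      assert (Fe : free Q (C ∖ {[e]})).
      { apply NNPP. intro H.
        assert (H' : (C ∖ {[e]}) e) by (apply (Hmin (C ∖ {[e]})); [sets|exact H|exact Ce]).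
        apply (proj2 H'). reflexivity. }
      apply HC. apply (free_subset Q _ ((C ∖ {[e]}) ∪ {[e]})); [|sets].
      apply free_add; [exact Fe|exact Hn].
Qed.

Lemma splits_compl Q A : splits Q A -> splits Q (∁ A).
Proof.
  intros [H1 H2]. split; intros X e He Ae.
  - exact (H2 _ _ He Ae).
  - generalize (H1 _ _ He (NNPP _ Ae)). apply cl_mono. sets.
Qed.

Lemma finitary_plus_cofinitary_space M : finitary_plus_cofinitary M ->
  exists A, splits (matroid_space M) A /\
    (forall e, A e -> finitary_at (matroid_space M) e) /\
    (forall e, ~ A e -> finitary_at (dual (matroid_space M)) e).
Proof.
  intros [A [Hsum [Hfin Hcofin]]]. exists A.
  assert (HA : splits (matroid_space M) A).
  { split; intros X e [Xe|[I [HIX [HI Hd]]]] Ae; try (left; tauto); right.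
    - exists (I ∩ A). split; [sets|]. split; [apply Hsum in HI; tauto|].
      intro H. apply Hd. apply Hsum. split.
      + apply (indep_subset E M _ _ H). sets.
      + apply (indep_subset E M _ I HI). sets.
    - exists (I ∖ A). split; [sets|]. split; [apply Hsum in HI; tauto|].
      intro H. apply Hd. apply Hsum. split.
      + apply (indep_subset E M _ I HI). sets.
      + apply (indep_subset E M _ _ H). sets. }
  split; [exact HA|]. split.
  - apply circuits_finitary; [exact HA|]. intros C HC. apply Hfin. revert HC.
    apply circuit_of_iff. intro X. symmetry. apply matroid_free.
  - apply (circuits_finitary _ (∁ A)); [apply splits_compl, dual_splits; exact HA|].
    intros C HC. apply Hcofin. revert HC.
    apply circuit_of_iff. intro X. symmetry. apply dual_indep_free.
Qed.

Lemma contract_splits Q A C : splits Q A -> splits (contract Q C) A.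
Proof.
  intros [H1 H2]. split; intros X e He Ae.
  - generalize (H1 _ _ He Ae). cbn [cl contract]. apply (cl_mono Q). sets.
  - generalize (H2 _ _ He Ae). cbn [cl contract]. apply (cl_mono Q). sets.
Qed.

Lemma contract_finitary Q C e : finitary_at Q e -> finitary_at (contract Q C) e.
Proof.
  intros H X He. destruct (H _ He) as [F [HF [HFX Hc]]]. exists (F ∩ X).
  split; [apply (finite_subset _ F HF); sets|]. split; [sets|].
  cbn [cl contract]. revert Hc. apply (cl_mono Q). intros x Fx. destruct (HFX x Fx); tauto.
Qed.

Lemma contract_dual_finitary Q C e : finitary_at (dual Q) e ->
  finitary_at (dual (contract Q C)) e.
Proof.
  intros H X [Xe|He].
  - exists {[e]}. split; [exists (e :: nil); intros x ->; left; reflexivity|].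
    split; [intros x ->; exact Xe|apply cl_in; reflexivity].
  - cbn [cl contract] in He.
    assert (Ce : ~ C e) by (intro; apply He; apply cl_in; tauto).
    assert (Hd : cl (dual Q) (X ∖ C) e).
    { right. intro Hc. apply He. revert Hc. apply cl_mono. sets. }
    destruct (H _ Hd) as [F [HF [HFX Hc]]]. exists F.
    split; [exact HF|]. split; [intros x Fx; apply (HFX x Fx)|].
    destruct Hc as [Hc|Hc]; [left; exact Hc|]. right. cbn [cl contract]. intro Hc'. apply Hc.
    revert Hc'. apply (cl_mono Q). intros x [Hx|Hx]; [exact Hx|].
    split; [|intros ->; tauto]. intro Fx. destruct (HFX x Fx). tauto.
Qed.

Lemma loop_finitary Q J e : finitary_at Q e -> finitary_at (loop Q J) e.
Proof.
  intros H X [He|He].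
  - exists (fun _ => False). split; [exists nil; tauto|]. split; [sets|left; exact He].
  - destruct (H _ He) as [F [HF [HFX Hc]]]. exists F.
    split; [exact HF|]. split; [intros x Fx; apply (HFX x Fx)|].
    right. revert Hc. apply cl_mono. intros x Fx. split; [exact Fx|]. apply HFX. exact Fx.
Qed.

Lemma finitary_dual_dual Q e : finitary_at Q e -> finitary_at (dual (dual Q)) e.
Proof.
  intros H X He. apply (proj1 (dual_dual Q X e)) in He. destruct (H X He) as [F [HF [HFX Hc]]].
  exists F. split; [exact HF|]. split; [exact HFX|]. apply (proj2 (dual_dual Q F e)). exact Hc.
Qed.

(* [contract P W] is P/W, and [dual (loop Q W)] is (Q - W)^* in which the
   elements of W are coloops, so that no hindrance can involve them. *)
Lemma unhindered_quotient P Q W A B :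
  packing P (dual Q) W A B -> (forall x, in_wave P (dual Q) x -> W x) ->
  unhindered (contract P W) (dual (loop Q W)).
Proof.
  intros HW Hmax W' A' B' h [[HA' [HB' [D' [HP' HQ']]]] [Wh [Ah Bh]]].
  assert (HQ1 : forall x, W' x -> B' x \/ (~ W x /\ cl (dual Q) (B' ∪ W) x)).
  { intros x Hx. destruct (HQ' x Hx) as [H|H]; [tauto|]. right.
    assert (Hx' : ~ W x) by (intro Wx; apply H; left; exact Wx). split; [exact Hx'|].
    right. intro Hc. apply H. right. revert Hc. apply cl_mono. sets. }
  assert (HhW : ~ W h) by (destruct (HQ1 h Wh); tauto).
  apply HhW. apply Hmax. destruct HW as [HA [HB [D [HP HQ]]]].
  exists (W ∪ W'), (A ∪ (A' ∖ W)), (B ∪ (B' ∖ W)). split; [|tauto].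
  unfold packing. split; [sets|]. split; [sets|].
  split.
  { intros x [Hx|Hx] [Hx'|Hx'];
      [apply (D x)| |apply (proj2 Hx)|apply (D' x)]; try tauto; auto; sets. }
  assert (HP1 : W ⊆ cl P (A ∪ (A' ∖ W))).
  { intros x Hx. generalize (HP x Hx). apply cl_mono. sets. }
  assert (HQ2 : W ⊆ cl (dual Q) (B ∪ (B' ∖ W))).
  { intros x Hx. generalize (HQ x Hx). apply cl_mono. sets. }
  split.
  - intros x [Hx|Hx]; [auto|]. generalize (HP' x Hx). cbn [cl contract]. apply (cl_trans P).
    intros y [Hy|Hy]; [|auto]. destruct (classic (W y)); [auto|apply cl_in; tauto].
  - assert (HB2 : (B' ∪ W) ⊆ cl (dual Q) (B ∪ (B' ∖ W))).
    { intros y [Hy|Hy]; [|auto]. destruct (classic (W y)); [auto|apply cl_in; tauto]. }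
    intros x [Hx|Hx]; [auto|]. destruct (HQ1 x Hx) as [H|[_ H]]; [apply HB2; tauto|].
    revert H. apply cl_trans. exact HB2.
Qed.

End Circuits.

Lemma matroid_cl_span (E : Type) (M : matroid E) (X : E -> Prop) : matroid_cl M X ⊆ span M X.
Proof.
  intros e He. destruct (classic (X e)) as [Xe|Xe]; [left; exact Xe|right].
  destruct (circuit_exists (matroid_space M) X e He Xe) as [C [HC [Ce HCX]]].
  exists C. split; [revert HC; apply circuit_of_iff; intro Y; symmetry; apply matroid_free|].
  split; [exact Ce|]. intros x Cx Hx. destruct (HCX x Cx); tauto.
Qed.

Theorem mainTheorem2 (E : Type) (M N : matroid E) :
  countable_type E ->
  finitary_plus_cofinitary M ->
  finitary_plus_cofinitary N ->
  exists (I : E -> Prop) (EM EN : E -> Prop),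
    indep M I /\ indep N I /\
    (forall x, EM x \/ EN x) /\ (forall x, ~ (EM x /\ EN x)) /\
    spans M (fun x => I x /\ EM x) EM /\
    spans N (fun x => I x /\ EN x) EN.
Proof.
  intros [f Hf] HM HN.
  destruct (finitary_plus_cofinitary_space M HM) as [A [SA [FA CA]]].
  destruct (finitary_plus_cofinitary_space N HN) as [B [SB [FB CB]]].
  set (P := matroid_space M) in *. set (Q := matroid_space N) in *.
  destruct (max_packing P (dual Q) f Hf) as [S [T HW]].
  set (W := in_wave P (dual Q)) in *.
  assert (HU : unhindered (contract P W) (dual (loop Q W))).
  { apply (unhindered_quotient P Q W S T HW). intros x Hx. exact Hx. }
  (* ∁ A is where the dual of M is finitary; B is where N, the dual of the second space, is. *)
  destruct (unhindered_cover (contract P W) (dual (loop Q W)) (∁ A) B f Hf) as [J [FJ FJ']].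
  { apply splits_compl, contract_splits. exact SA. }
  { intros e Ae. apply contract_dual_finitary. auto. }
  { intros e Ae. apply contract_finitary. apply FA. apply NNPP. exact Ae. }
  { apply dual_splits, loop_splits. exact SB. }
  { intros e Be. apply finitary_dual_dual, loop_finitary. auto. }
  { intros e Be. apply loop_dual_finitary. auto. }
  { exact HU. }
  destruct HW as [HS [HT [D [HP HQ]]]].
  assert (JW : forall x, J x -> ~ W x).
  { intros x Jx Wx. apply (FJ x Jx). cbn [cl contract]. apply (cl_in P). tauto. }
  destruct (cl_base P (Z := fun _ => False) (X := S)) as [S1 [_ [HS1 [FS1 SS1]]]]; [sets|sets|].
  destruct (cl_base Q (Z := fun _ => False) (X := J)) as [J1 [_ [HJ1 [FJ1 SJ1]]]]; [sets|sets|].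
  assert (HS1W : S1 ⊆ W) by sets.
  assert (HJ1W : forall x, J1 x -> ~ W x) by (intros x Hx; auto).
  exists (S1 ∪ J1), W, (∁ W). split; [|split; [|split; [|split; [|split]]]].
  - apply matroid_free. fold P. apply (free_subset P _ (J1 ∪ S1)); [|sets].
    apply free_union; [exact FS1|]. intros x Jx Hc. apply (FJ x); [auto|].
    cbn [cl contract]. revert Hc. apply (cl_mono P). sets.
  (* T spans W in the dual of N and is disjoint from [S1] and [J1], so by duality no element of [S1]
     is N-spanned by the other elements. *)
  - apply matroid_free. fold Q. apply free_union; [exact FJ1|]. intros x Sx.
    assert (Wx : W x) by auto.
    apply (disjoint_dual Q T).
    + apply HQ. exact Wx.
    + intros y Ty [[Sy _]|Jy]; [apply (D y); auto|apply (HJ1W y); auto].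
    + apply D. auto.
    + intros [[_ Hx]|Jx]; [tauto|apply (HJ1W x); auto].
  - intro x. apply classic.
  - tauto.
  - intros x Wx. apply matroid_cl_span. change (cl P ((S1 ∪ J1) ∩ W) x).
    apply (cl_trans P S1); [intros y Sy; apply cl_in; auto|].
    apply (cl_trans P S); auto.
  - intros x Wx. apply matroid_cl_span. change (cl Q ((S1 ∪ J1) ∩ ∁ W) x).
    apply (cl_trans Q J1); [intros y Jy; apply cl_in; split; auto|].
    apply (cl_trans Q J); [exact SJ1|].
    (* ∁ J is free in the dual of [loop Q W], so J spans every element off W in N. *)
    destruct (classic (J x)) as [Jx|Jx]; [apply cl_in; exact Jx|].
    pose proof (FJ' x Jx) as H. apply not_dual in H. destruct H as [H|H]; [tauto|].
    revert H. apply cl_mono. intros y [[Hy Hyx] _]. apply NNPP. tauto.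
Qed.
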